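(* Let $M$ be an $n$-dimensional Kaehlerian slant submanifold, with slant angle $\theta$, of a $2n$-dimensional complex space form $\widetilde M(c)$, and let $X$ be a unit tangent vector in $T_p^1M$, $p\in M$. Then $$\mathrm{Ric}(X)\le\frac14\left((n-1)\,n\,\|H\|^2+(n-1)c+3c\cos^2\theta\right),$$ where $H$ is the mean curvature vector of $M$ in $\widetilde M(c)$ and $\mathrm{Ric}(X)$ is the Ricci curvature of $M$ at $X$. The equality sign holds for every unit tangent vector at $p$ if and only if either (a) $p$ is a geodesic point, or (b) $n=2$ and, at $p$, for some orthonormal tangent vectors $e_1,e_2$ and some suitable function $\mu$, $$\sigma(e_1,e_1)=3\mu\,\frac{Fe_1}{\|Fe_1\|}=3\mu\csc\theta\,Fe_1,$$ $$\sigma(e_2,e_2)=\mu\,\frac{Fe_1}{\|Fe_1\|}=\mu\csc\theta\,Fe_1,$$ $$\sigma(e_1,e_2)=\mu\,\frac{Fe_2}{\|Fe_2\|}=\mu\csc\theta\,Fe_2,$$ where $\sigma$ is the second fundamental form of the immersion of $M$ into $\widetilde M(c)$.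
   Context: All dimensions are real dimensions. A complex space form $\widetilde M(c)$ is a Kaehler manifold $(\widetilde M,J,g)$ of constant holomorphic sectional curvature $c$. $T_p^1M$ is the set of unit vectors in $T_pM$. Let $M$ be a submanifold of an almost Hermitian manifold $(\widetilde M,J,g)$. For $X\in TM$ write $JX=PX+FX$, where $PX$ is the tangential and $FX$ the normal component of $JX$. For a nonzero $X\in T_pM$ the Wirtinger angle $\theta(X)$ is the angle between $JX$ and $T_pM$. $M$ is a slant submanifold if $\theta(X)$ is independent of the choice of $p\in M$ and of nonzero $X\in T_pM$; the constant value $\theta$ is the slant angle. Slant $M$ is proper slant if $0\ne\theta\ne\pi/2$. A proper slant submanifold is Kaehlerian slant if the endomorphism $P$ of $TM$ is parallel with respect to the Levi-Civita connection of $M$. $\sigma$ denotes the second fundamental form of $M$ in $\widetilde M(c)$, $H=\frac1n\mathrm{trace}(\sigma)$ is the mean curvature vector, and $p\in M$ is a geodesic point if $\sigma=0$ at $p$. $\mathrm{Ric}(X)$ for a unit vector $X\in T_pM$ is the sum of the sectional curvatures (of the induced metric) of the planes spanned by $X$ and $e_j$, $j=2,\ldots,n$, where $\{X,e_2,\ldots,e_n\}$ is an orthonormal basis of $T_pM$. *)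

(* Defs.v *)
(* Manifolds are given by smooth atlases, and tensors by their components in
   the charts together with the transformation law.  A tangent vector at a
   point of a chart domain is written as the row vector of its components in
   that chart, so a Jacobian ['J f x] acts on tangent vectors by
   [X |-> X *m 'J f x], and an endomorphism of a tangent space with matrix [A]
   acts by [X |-> X *m A]. *)
From HB Require Import structures.
From mathcomp Require Import all_boot all_order all_algebra.
From mathcomp Require Import all_classical all_reals all_analysis.
Import Order.TTheory GRing.Theory Num.Theory.
Import numFieldNormedType.Exports.

Set Implicit Arguments.
Unset Strict Implicit.
Unset Printing Implicit Defensive.

Local Open Scope classical_set_scope.
Local Open Scope ring_scope.

(* For [V] finite-dimensional and [U] open, [k]-fold Frechet differentiability
   of [f] on [U] is differentiability of [f] together with [(k-1)]-fold
   differentiability of every directional derivative. *)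
Fixpoint differentiable_upto (R : realType) (V W : normedModType R) (k : nat)
    (U : set V) (f : V -> W) : Prop :=
  if k is k'.+1 then
    (forall x, U x -> differentiable f x) /\
    (forall v, differentiable_upto k' U ('D_v f))
  else True.

Definition smooth_on (R : realType) (V W : normedModType R) (U : set V)
    (f : V -> W) : Prop :=
  forall k, differentiable_upto k U f.

(* [chart_inv] is only meaningful on the image of the chart. *)
Record chart (R : realType) (M : topologicalType) (n : nat) := Chart {
  chart_dom : set M ;
  chart_map :> M -> 'rV[R]_n ;
  chart_inv : 'rV[R]_n -> M ;
  chart_domO : open chart_dom ;
  chart_codO : open (chart_map @` chart_dom) ;
  chart_mapK : forall p, chart_dom p -> chart_inv (chart_map p) = p ;
  chart_map_continuous :
    forall p, chart_dom p -> {for p, continuous chart_map} ;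
  chart_inv_continuous :
    forall p, chart_dom p -> {for chart_map p, continuous chart_inv} }.

Definition coord_map (R : realType) (M N : topologicalType) (m n : nat)
    (phi : chart R M m) (psi : chart R N n) (f : M -> N) :
    'rV[R]_m -> 'rV[R]_n :=
  fun x => psi (f (chart_inv phi x)).

Definition coord_dom (R : realType) (M N : topologicalType) (m n : nat)
    (phi : chart R M m) (psi : chart R N n) (f : M -> N) : set 'rV[R]_m :=
  phi @` (chart_dom phi `&` f @^-1` chart_dom psi).

Record manifold (R : realType) (n : nat) := Manifold {
  manifold_space :> topologicalType ;
  atlas : set (chart R manifold_space n) ;
  manifold_hausdorff : hausdorff_space manifold_space ;
  manifold_second_countable : @second_countable manifold_space ;
  atlas_cover : forall p, exists2 phi, atlas phi & chart_dom phi p ;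
  atlas_smooth : forall phi psi, atlas phi -> atlas psi ->
    smooth_on (coord_dom phi psi id) (coord_map phi psi id) }.

Definition chart_at (R : realType) (n : nat) (M : manifold R n) (p : M)
    (phi : chart R M n) : Prop :=
  atlas phi /\ chart_dom phi p.

Definition smooth_map (R : realType) (m n : nat) (M : manifold R m)
    (N : manifold R n) (f : M -> N) : Prop :=
  continuous f /\
  forall (phi : chart R M m) (psi : chart R N n), atlas phi -> atlas psi ->
    smooth_on (coord_dom phi psi f) (coord_map phi psi f).

Definition immersion (R : realType) (m n : nat) (M : manifold R m)
    (N : manifold R n) (f : M -> N) : Prop :=
  smooth_map f /\
  forall (p : M) (phi : chart R M m) (psi : chart R N n),
    chart_at p phi -> chart_at (f p) psi ->
    row_free ('J (coord_map phi psi f) (phi p)).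

Definition dotm (R : realType) (n : nat) (A : 'M[R]_n) (X Y : 'rV[R]_n) : R :=
  (X *m A *m Y^T) 0 0.

Definition normm (R : realType) (n : nat) (A : 'M[R]_n) (X : 'rV[R]_n) : R :=
  Num.sqrt (dotm A X X).

Definition partial (R : realType) (n : nat) (W : normedModType R) (i : 'I_n)
    (f : 'rV[R]_n -> W) (x : 'rV[R]_n) : W :=
  'D_(delta_mx 0 i) f x.

(* [Gamma^k_ij]: the index [k] is the upper one. *)
Definition christoffel (R : realType) (n : nat) (g : 'rV[R]_n -> 'M[R]_n)
    (x : 'rV[R]_n) (k i j : 'I_n) : R :=
  2^-1 * \sum_l invmx (g x) k l *
    (partial i (fun y => g y j l) x + partial j (fun y => g y i l) x
     - partial l (fun y => g y i j) x).

Definition christoffel_form (R : realType) (n : nat)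
    (g : 'rV[R]_n -> 'M[R]_n) (x X Y : 'rV[R]_n) : 'rV[R]_n :=
  \row_k \sum_i \sum_j christoffel g x k i j * X 0 i * Y 0 j.

(* For a vector field [V] along [F : R^n -> (R^m, g)], the derivative
   [nabla_X V] at [x], for the Levi-Civita connection [nabla] of [g]. *)
Definition nabla_along (R : realType) (n m : nat) (g : 'rV[R]_m -> 'M[R]_m)
    (F : 'rV[R]_n -> 'rV[R]_m) (X : 'rV[R]_n) (V : 'rV[R]_n -> 'rV[R]_m)
    (x : 'rV[R]_n) : 'rV[R]_m :=
  'D_X V x + christoffel_form g (F x) (X *m 'J F x) (V x).

Definition nabla (R : realType) (n : nat) (g : 'rV[R]_n -> 'M[R]_n)
    (X : 'rV[R]_n) (Y : 'rV[R]_n -> 'rV[R]_n) (x : 'rV[R]_n) : 'rV[R]_n :=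
  'D_X Y x + christoffel_form g x X (Y x).

(* [R(X, Y)Z], with the sign for which spheres have positive curvature.  The vectors are extended by constant components, so that
   [[X, Y] = 0] and no [nabla_[X, Y] Z] term appears. *)
Definition curvature (R : realType) (n : nat) (g : 'rV[R]_n -> 'M[R]_n)
    (x X Y Z : 'rV[R]_n) : 'rV[R]_n :=
  nabla g X (nabla g Y (cst Z)) x - nabla g Y (nabla g X (cst Z)) x.

Definition sectional (R : realType) (n : nat) (g : 'rV[R]_n -> 'M[R]_n)
    (x X Y : 'rV[R]_n) : R :=
  dotm (g x) (curvature g x X Y Y) X /
  (dotm (g x) X X * dotm (g x) Y Y - dotm (g x) X Y ^+ 2).

Definition orthonormal_basis (R : realType) (n : nat) (A : 'M[R]_n)
    (e : 'I_n -> 'rV[R]_n) : Prop :=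
  forall i j, dotm A (e i) (e j) = (i == j)%:R.

(* The sum does not depend on the orthonormal basis completing [X]; [xget]
   selects its value. *)
Definition Ric (R : realType) (n : nat) (g : 'rV[R]_n -> 'M[R]_n)
    (x X : 'rV[R]_n) : R :=
  xget 0 [set r | exists (e : 'I_n -> 'rV[R]_n) (i : 'I_n),
    [/\ orthonormal_basis (g x) e, e i = X &
        r = \sum_(j | j != i) sectional g x X (e j)]].

(* [nabla A = 0] at [x] for a field [A] of endomorphisms, tested on vector
   fields [Y] with constant components. *)
Definition parallel_at (R : realType) (n : nat) (g : 'rV[R]_n -> 'M[R]_n)
    (A : 'rV[R]_n -> 'rV[R]_n -> 'rV[R]_n) (x : 'rV[R]_n) : Prop :=
  forall X Y, nabla g X (fun y => A y Y) x = A x (nabla g X (cst Y) x).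

Record riemannian_metric (R : realType) (n : nat) (M : manifold R n) :=
  RiemannianMetric {
  metric :> chart R M n -> 'rV[R]_n -> 'M[R]_n ;
  metric_smooth : forall phi, atlas phi ->
    smooth_on (phi @` chart_dom phi) (metric phi) ;
  metric_sym : forall p phi, chart_at p phi ->
    (metric phi (phi p))^T = metric phi (phi p) ;
  metric_posdef : forall p phi, chart_at p phi ->
    forall X, X != 0 -> 0 < dotm (metric phi (phi p)) X X ;
  metric_transition : forall p phi psi, chart_at p phi -> chart_at p psi ->
    let T := 'J (coord_map phi psi id) (phi p) in
    metric phi (phi p) = T *m metric psi (psi p) *m T^T }.

Record almost_complex_structure (R : realType) (n : nat) (M : manifold R n) :=
  AlmostComplexStructure {
  acs :> chart R M n -> 'rV[R]_n -> 'M[R]_n ;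
  acs_smooth : forall phi, atlas phi ->
    smooth_on (phi @` chart_dom phi) (acs phi) ;
  acs_sqr : forall p phi, chart_at p phi ->
    acs phi (phi p) *m acs phi (phi p) = - 1%:M ;
  acs_transition : forall p phi psi, chart_at p phi -> chart_at p psi ->
    let T := 'J (coord_map phi psi id) (phi p) in
    acs phi (phi p) *m T = T *m acs psi (psi p) }.

Record almost_hermitian (R : realType) (n : nat) := AlmostHermitian {
  ah_manifold :> manifold R n ;
  ah_metric : riemannian_metric ah_manifold ;
  ah_J : almost_complex_structure ah_manifold ;
  ah_compatible : forall p phi, chart_at p phi -> forall X Y,
    dotm (ah_metric phi (phi p)) (X *m ah_J phi (phi p))
      (Y *m ah_J phi (phi p)) = dotm (ah_metric phi (phi p)) X Y }.

(* [nabla J = 0] for the Levi-Civita connection. *)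
Definition kaehler (R : realType) (n : nat) (N : almost_hermitian R n) : Prop :=
  forall (p : N) phi, chart_at p phi ->
    parallel_at (ah_metric N phi) (fun y Y => Y *m ah_J N phi y) (phi p).

Definition complex_space_form (R : realType) (n : nat)
    (N : almost_hermitian R n) (c : R) : Prop :=
  kaehler N /\
  forall (p : N) phi, chart_at p phi -> forall X, X != 0 ->
    sectional (ah_metric N phi) (phi p) X (X *m ah_J N phi (phi p)) = c.

Record local_immersion (R : realType) (n m : nat) := LocalImmersion {
  imm_map :> 'rV[R]_n -> 'rV[R]_m ;
  amb_metric : 'rV[R]_m -> 'M[R]_m ;
  amb_J : 'rV[R]_m -> 'M[R]_m }.

Definition in_charts (R : realType) (n m : nat) (M : manifold R n)
    (N : almost_hermitian R m) (f : M -> N) (phi : chart R M n)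
    (psi : chart R N m) : local_immersion R n m :=
  LocalImmersion (coord_map phi psi f) (ah_metric N psi) (ah_J N psi).

Definition amb_norm (R : realType) (n m : nat) (S : local_immersion R n m)
    (x : 'rV[R]_n) (V : 'rV[R]_m) : R :=
  normm (amb_metric S (S x)) V.

Definition induced_metric (R : realType) (n m : nat)
    (S : local_immersion R n m) (x : 'rV[R]_n) : 'M[R]_n :=
  'J S x *m amb_metric S (S x) *m ('J S x)^T.

(* The vector [T] of [T_pM] whose image [T *m 'J S x] is the orthogonal
   projection of [V] on the tangent space of the submanifold. *)
Definition tangential_part (R : realType) (n m : nat) (S : local_immersion R n m)
    (x : 'rV[R]_n) (V : 'rV[R]_m) : 'rV[R]_n :=
  V *m amb_metric S (S x) *m ('J S x)^T *m invmx (induced_metric S x).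

Definition normal_part (R : realType) (n m : nat) (S : local_immersion R n m)
    (x : 'rV[R]_n) (V : 'rV[R]_m) : 'rV[R]_m :=
  V - tangential_part S x V *m 'J S x.

Definition JX (R : realType) (n m : nat) (S : local_immersion R n m)
    (x X : 'rV[R]_n) : 'rV[R]_m :=
  X *m 'J S x *m amb_J S (S x).

Definition PX (R : realType) (n m : nat) (S : local_immersion R n m)
    (x X : 'rV[R]_n) : 'rV[R]_n :=
  tangential_part S x (JX S x X).

Definition FX (R : realType) (n m : nat) (S : local_immersion R n m)
    (x X : 'rV[R]_n) : 'rV[R]_m :=
  normal_part S x (JX S x X).

(* Angle between the vector [JX] and its orthogonal projection on [T_pM]. *)
Definition wirtinger_angle (R : realType) (n m : nat)
    (S : local_immersion R n m) (x X : 'rV[R]_n) : R :=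
  acos (normm (induced_metric S x) (PX S x X) / amb_norm S x (JX S x X)).

(* The normal part of [nabla_X Y] in the ambient manifold, with [Y] extended
   by constant components. *)
Definition second_ff (R : realType) (n m : nat) (S : local_immersion R n m)
    (x X Y : 'rV[R]_n) : 'rV[R]_m :=
  normal_part S x (nabla_along (amb_metric S) S X (fun y => Y *m 'J S y) x).

Definition geodesic_point (R : realType) (n m : nat)
    (S : local_immersion R n m) (x : 'rV[R]_n) : Prop :=
  forall X Y, second_ff S x X Y = 0.

(* The trace of [second_ff] is taken with respect to the induced metric. *)
Definition mean_curvature (R : realType) (n m : nat)
    (S : local_immersion R n m) (x : 'rV[R]_n) : 'rV[R]_m :=
  n%:R^-1 *: \sum_i \sum_j invmx (induced_metric S x) i j *:
    second_ff S x (delta_mx 0 i) (delta_mx 0 j).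

Definition slant (R : realType) (n m : nat) (M : manifold R n)
    (N : almost_hermitian R m) (f : M -> N) (theta : R) : Prop :=
  forall (p : M) phi psi, chart_at p phi -> chart_at (f p) psi ->
  forall X, X != 0 -> wirtinger_angle (in_charts f phi psi) (phi p) X = theta.

Definition proper_slant (R : realType) (n m : nat) (M : manifold R n)
    (N : almost_hermitian R m) (f : M -> N) (theta : R) : Prop :=
  [/\ slant f theta, theta != 0 & theta != pi / 2].

Definition kaehlerian_slant (R : realType) (n m : nat) (M : manifold R n)
    (N : almost_hermitian R m) (f : M -> N) (theta : R) : Prop :=
  proper_slant f theta /\
  forall (p : M) phi psi, chart_at p phi -> chart_at (f p) psi ->
    let S := in_charts f phi psi in
    parallel_at (induced_metric S) (PX S) (phi p).

(* Main.v *)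
(* By the Gauss equation Ric(X) is the curvature part of the bound plus a
   quadratic expression in sigma.  On a Kaehlerian slant submanifold
   <sigma(X, Y), FZ> is symmetric in X, Y, Z, because P is parallel, and F / sin
   theta is an isometry from the tangent space onto the normal space, because M
   has half the dimension of the ambient manifold.  So sigma is a symmetric cubic
   form a_ijk, and with T_l = sum_j a_jjl the difference between the two sides
   of the inequality at X = e_i is a sum of squares of linear forms in a.  When
   these vanish for all e_i, either a = 0 or n = 2, and in the latter case it
   remains to take e_1 in the direction dual to the mean curvature vector. *)
From HB Require Import structures.
Require Import Defs.
From mathcomp Require Import all_boot all_order all_algebra.
From mathcomp Require Import all_classical all_reals all_analysis.
From mathcomp Require Import ring lra.
Import Order.TTheory GRing.Theory Num.Theory.
Import numFieldNormedType.Exports.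

Set Implicit Arguments.
Unset Strict Implicit.
Unset Printing Implicit Defensive.
Local Open Scope classical_set_scope.
Local Open Scope ring_scope.

(** * Differential calculus *)

(** All tensor calculus is done on row vectors in one chart of each manifold, with fields of
    constant components: brackets vanish, and covariant identities reduce to the product rule and
    the symmetry of second derivatives. The connection is used along a map [F], so that the ambient
    manifold ([F] the identity) and the submanifold ([F] the immersion) share the same lemmas.

    The curvature part needs every ambient sectional curvature, whereas only the holomorphic ones
    are given; the Kaehler symmetries recover the others by polarisation. For a unit vector [X] the
    terms [<P X, e_j>^2] then add up to [|P X|^2 = cos^2 theta].

    The coefficient [n (n - 1) / 4] of [|H|^2] is [(n - 1) / (4 n)] for the trace [n H]. With it,
    completing squares leaves [(n - 2) / (8 n) T_l^2]: this is why [n = 2] is exceptional and why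
    for larger [n] equality forces the trace to vanish.

    Dividing by [sin theta] requires its positivity, and the squares require [n > 1]; both are
    extracted from proper slantness. Finally, [Ric] is computed in an unknown basis, so the
    quadratic expression in sigma must be shown to depend on [X] alone. *)

Section Calculus.
Context {R : realType}.

Section General.
Context {V W : normedModType R}.

Lemma diff_scale (k : V -> R) (f : V -> W) x :
  differentiable k x -> differentiable f x ->
  differentiable (fun y => k y *: f y) x /\
  forall v, 'D_v (fun y => k y *: f y) x = 'D_v k x *: f x + k x *: 'D_v f x.
Proof.
move=> dk df.
have blm : bilinear_for (GRing.Scale.Law.clone _ _ *:%R _)
   (GRing.Scale.Law.clone _ _ *:%R _) (fun (c : R) (w : W) => c *: w).
  split=> [u|u] a y z /=.
  - by rewrite scalerDl scalerA.
  - by rewrite scalerDr !scalerA mulrC.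
pose bM := bilinear_isBilinear.Build R R W W _ _ _ blm.
pose b : {bilinear R -> W -> W} := HB.pack (fun (c : R) (w : W) => c *: w) bM.
have cb : continuous (fun p : R * W => b p.1 p.2).
  by move=> p; exact: scale_continuous.
have db := differentiable_bilin (k x, f x) cb.
have dp := differentiable_pair dk df.
have dkf : differentiable (fun y => k y *: f y) x := differentiable_comp dp db.
split=> // v; rewrite !deriveE //.
have -> : (fun y => k y *: f y) =
  (fun p : R * W => b p.1 p.2) \o (fun y => (k y, f y)) by [].
rewrite (diff_comp dp db) /=.
have -> := diff_bilin (k x, f x) cb.
have -> := diff_pair dk df.
by rewrite /= addrC.
Qed.

(** Differentiability depends only on the germ: the linear part of [f] at [x] gives the first-order
    expansion of [g], and uniqueness makes it the differential of [g]. *)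
Lemma near_eq_differentiable (f g : V -> W) x :
  (\near x, f x = g x) -> differentiable f x -> differentiable g x.
Proof.
move=> fg df; have fgx : f x = g x := nbhs_singleton fg.
have H : continuous ('d f x) /\ g \o shift x = cst (g x) + 'd f x +o_ 0 id.
  split; first exact: diff_continuous.
  have [_ /eqaddoP ef] := (diff_locallyP _ _).1 df.
  apply/eqaddoP => _/posnumP[e]; near=> h.
  have hfg : f (h + x) = g (h + x).
    near: h; have := fg; rewrite (near_shift 0 x) /=.
    by apply: filterS => y; rewrite /= subr0.
  rewrite /= !fctE /= -fgx -hfg.
  by near: h; exact: ef.
apply/diff_locallyP; have [cd eg] := H.
by rewrite (diff_unique cd eg).
Unshelve. all: by end_near. Qed.

Lemma near_open (U : set V) x (P : V -> Prop) :
  open U -> U x -> (forall y, U y -> P y) -> \near x, P x.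
Proof. by move=> oU Ux h; apply: filterS h _; exact: open_nbhs_nbhs. Qed.

Lemma differentiable_sumf (I : Type) (r : seq I) (P : pred I) (f : I -> V -> W) x :
  (forall i, P i -> differentiable (f i) x) ->
  differentiable (fun y => \sum_(i <- r | P i) f i y) x.
Proof.
move=> df; elim: r => [|i r IH].
  rewrite (_ : (fun y => _) = cst 0); first exact: differentiable_cst.
  by apply/funext => y; rewrite big_nil.
rewrite (_ : (fun y => _) = if P i then f i + (fun y => \sum_(j <- r | P j) f j y)
  else (fun y => \sum_(j <- r | P j) f j y)); last first.
  by apply/funext => y; rewrite big_cons; case: ifP.
by case: ifP => [Pi|_]; [exact: (differentiableD (df i Pi) IH)|exact: IH].
Qed.

Lemma derive_sumf (I : Type) (r : seq I) (P : pred I) (f : I -> V -> W) x v :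
  (forall i, P i -> differentiable (f i) x) ->
  'D_v (fun y => \sum_(i <- r | P i) f i y) x = \sum_(i <- r | P i) 'D_v (f i) x.
Proof.
move=> df; elim: r => [|i r IH].
  rewrite (_ : (fun y => _) = cst 0) ?derive_cst ?big_nil //.
  by apply/funext => y; rewrite big_nil.
rewrite (_ : (fun y => _) = if P i then f i + (fun y => \sum_(j <- r | P j) f j y)
  else (fun y => \sum_(j <- r | P j) f j y)); last first.
  by apply/funext => y; rewrite big_cons; case: ifP.
rewrite big_cons; case: ifP => // Pi.
rewrite deriveD ?IH //; apply: diff_derivable; first exact: df.
exact: differentiable_sumf.
Qed.

End General.

Lemma derive_comp (U V W : normedModType R) (f : U -> V) (g : V -> W) x v :
  differentiable f x -> differentiable g (f x) ->
  'D_v (fun y => g (f y)) x = 'D_('D_v f x) g (f x).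
Proof.
move=> df dg; rewrite !deriveE //; last exact: (differentiable_comp df dg).
by rewrite (diff_comp df dg).
Qed.

Section Matrices.
Context {V : normedModType R}.

Lemma differentiable_entry m n (A : V -> 'M[R]_(m, n)) x i j :
  differentiable A x -> differentiable (fun y => A y i j) x.
Proof. by move=> dA; exact: (differentiable_comp dA (differentiable_coord _ i j)). Qed.

Lemma derive_entry m n (A : V -> 'M[R]_(m, n)) x v i j :
  differentiable A x -> 'D_v A x i j = 'D_v (fun y => A y i j) x.
Proof. by move=> dA; rewrite derive_mx ?mxE //; exact: diff_derivable. Qed.

(** Leibniz rule for a bilinear expression whose coefficients also move with [y], as a metric or a
    Christoffel form along a map does. Expansion in the standard bases reduces it to the scalar
    product rule, so differentiability of [B] is asked only with its arguments frozen. *)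
Lemma diff_bilin_family (W : normedModType R) a b
    (B : V -> 'rV[R]_a -> 'rV[R]_b -> W) (u : V -> 'rV[R]_a) (v : V -> 'rV[R]_b) x :
  (forall y s s' c w, B y (c *: s + s') w = c *: B y s w + B y s' w) ->
  (forall y s c w w', B y s (c *: w + w') = c *: B y s w + B y s w') ->
  (forall s w, differentiable (fun y => B y s w) x) ->
  differentiable u x -> differentiable v x ->
  differentiable (fun y => B y (u y) (v y)) x /\
  forall d, 'D_d (fun y => B y (u y) (v y)) x =
    'D_d (fun y => B y (u x) (v x)) x + B x ('D_d u x) (v x) + B x (u x) ('D_d v x).
Proof.
move=> linl linr dB du dv.
have l0 y w : B y 0 w = 0.
  by have := linl y 0 0 (-1) w; rewrite scaler0 addr0 scaleN1r addNr.
have r0 y s : B y s 0 = 0.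
  by have := linr y s (-1) 0 0; rewrite scaler0 addr0 scaleN1r addNr.
have lsum y (s : 'rV_a) w : B y s w = \sum_i s 0 i *: B y (delta_mx 0 i) w.
  rewrite {1}(row_sum_delta s); elim/big_rec2: _ => [//|i p q _ IH].
  by rewrite linl IH.
have rsum y s (w : 'rV_b) : B y s w = \sum_j w 0 j *: B y s (delta_mx 0 j).
  rewrite {1}(row_sum_delta w); elim/big_rec2: _ => [//|i p q _ IH].
  by rewrite linr IH.
have E y s w : B y s w =
    \sum_i s 0 i *: \sum_j w 0 j *: B y (delta_mx 0 i) (delta_mx 0 j).
  by rewrite lsum; apply: eq_bigr => i _; rewrite rsum.
have du' i := differentiable_entry 0 i du.
have dv' i := differentiable_entry 0 i dv.
have dc (c : R) (y : V) : differentiable (fun _ : V => c) y := differentiable_cst _ _.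
have d1 i j := (diff_scale (dv' j) (dB (delta_mx 0 i) (delta_mx 0 j))).1.
have d2 i := @differentiable_sumf _ _ _ (index_enum 'I_b) xpredT _ _ (fun j _ => d1 i j).
have -> : (fun y => B y (u y) (v y)) = (fun y =>
    \sum_i u y 0 i *: \sum_j v y 0 j *: B y (delta_mx 0 i) (delta_mx 0 j)).
  by apply/funext => y; exact: E.
split; first by apply: differentiable_sumf => i _; exact: (diff_scale (du' i) (d2 i)).1.
move=> d.
have -> : (fun y => B y (u x) (v x)) = (fun y =>
    \sum_i u x 0 i *: \sum_j v x 0 j *: B y (delta_mx 0 i) (delta_mx 0 j)).
  by apply/funext => y; exact: E.
have e1 i j := (diff_scale (dc (v x 0 j) x) (dB (delta_mx 0 i) (delta_mx 0 j))).1.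
have e2 i := @differentiable_sumf _ _ _ (index_enum 'I_b) xpredT _ _ (fun j _ => e1 i j).
rewrite derive_sumf; last by move=> i _; exact: (diff_scale (du' i) (d2 i)).1.
rewrite derive_sumf; last by move=> i _; exact: (diff_scale (dc _ x) (e2 i)).1.
rewrite (E x ('D_d u x)) (E x _ ('D_d v x)) -!big_split /=; apply: eq_bigr => i _.
rewrite (diff_scale (du' i) (d2 i)).2 (diff_scale (dc _ x) (e2 i)).2.
rewrite derive_cst scale0r add0r derive_entry // addrAC addrC; congr (_ + _).
rewrite -scalerDr; congr (_ *: _).
rewrite derive_sumf; last by move=> j _; exact: d1.
rewrite derive_sumf; last by move=> j _; exact: e1.
rewrite -big_split /=; apply: eq_bigr => j _.
rewrite (diff_scale (dv' j) (dB _ _)).2 (diff_scale (dc _ x) (dB _ _)).2.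
by rewrite derive_cst scale0r add0r derive_entry // addrC.
Qed.

(** A linear family becomes bilinear by adding a one-dimensional second argument, frozen at [1]. *)
Lemma diff_lin_family (W : normedModType R) a
    (L : V -> 'rV[R]_a -> W) (u : V -> 'rV[R]_a) x :
  (forall y s s' c, L y (c *: s + s') = c *: L y s + L y s') ->
  (forall s, differentiable (fun y => L y s) x) ->
  differentiable u x ->
  differentiable (fun y => L y (u y)) x /\
  forall d, 'D_d (fun y => L y (u y)) x = 'D_d (fun y => L y (u x)) x + L x ('D_d u x).
Proof.
move=> linL dL du.
pose B y (s : 'rV[R]_a) (w : 'rV[R]_1) := w 0 0 *: L y s.
have dc (w : W) (y : V) : differentiable (fun _ : V => w) y := differentiable_cst _ _.
pose v (y : V) : 'rV[R]_1 := const_mx 1.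
have dv : differentiable v x := differentiable_cst _ _.
have [|||d1 d2] := @diff_bilin_family W a 1%N B u v x _ _ _ du dv.
- by move=> y s s' c w; rewrite /B linL scalerDr !scalerA mulrC.
- by move=> y s c w w'; rewrite /B !mxE scalerDl scalerA.
- by move=> s w; exact: differentiableZ.
have BE y s z : B y s (v z) = L y s by rewrite /B mxE scale1r.
have -> : (fun y => L y (u y)) = (fun y => B y (u y) (v y)).
  by apply/funext => y; rewrite BE.
split=> // d; rewrite d2 BE derive_cst [in X in _ + X]/B mxE scale0r addr0.
by congr ('D_d _ x + _); apply/funext => y; rewrite BE.
Qed.

End Matrices.

End Calculus.

(** * Smooth maps on open sets *)

Section Smooth.
Context {R : realType}.

Section General.
Context {V : normedModType R} {U : set V}.
Hypothesis oU : open U.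

Lemma differentiable_upto_eq (W : normedModType R) k (f g : V -> W) :
  (forall y, U y -> f y = g y) ->
  differentiable_upto k U f -> differentiable_upto k U g.
Proof.
elim: k f g => [//|k IH] f g fg /= [df Df]; split=> [x Ux|v].
  by apply: near_eq_differentiable (df x Ux); exact: (near_open oU Ux).
apply: IH (Df v) => y Uy; apply: near_eq_derive; exact: (near_open oU Uy).
Qed.

Lemma differentiable_uptoS (W : normedModType R) k (f : V -> W) :
  differentiable_upto k.+1 U f -> differentiable_upto k U f.
Proof.
elim: k f => [//|k IH] f [df Df]; split=> // v; exact: IH (Df v).
Qed.

Lemma differentiable_upto_cst (W : normedModType R) k (c : W) :
  differentiable_upto k U (fun _ => c).
Proof.
elim: k c => [//|k IH] c; split=> [x _|v]; first exact: differentiable_cst.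
by apply: differentiable_upto_eq (IH 0) => y _; rewrite derive_cst.
Qed.

Lemma differentiable_upto_add (W : normedModType R) k (f g : V -> W) :
  differentiable_upto k U f -> differentiable_upto k U g ->
  differentiable_upto k U (fun y => f y + g y).
Proof.
elim: k f g => [//|k IH] f g [df Df] [dg Dg]; split=> [x Ux|v].
  by apply: differentiableD; auto.
apply: differentiable_upto_eq (IH _ _ (Df v) (Dg v)) => y Uy.
by rewrite deriveD //; apply: diff_derivable; auto.
Qed.

Lemma differentiable_upto_scale (W : normedModType R) k (f : V -> R) (g : V -> W) :
  differentiable_upto k U f -> differentiable_upto k U g ->
  differentiable_upto k U (fun y => f y *: g y).
Proof.
elim: k f g => [//|k IH] f g Hf Hg.
have [[df Df] [dg Dg]] := (Hf, Hg); split=> [x Ux|v].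
  by apply: (diff_scale _ _).1; auto.
apply: (@differentiable_upto_eq _ _ (fun y => 'D_v f y *: g y + f y *: 'D_v g y)).
  by move=> y Uy; rewrite (diff_scale _ _).2; auto.
by apply: differentiable_upto_add; apply: IH; first [exact: Df|exact: Dg|exact: (differentiable_uptoS Hg)|exact: (differentiable_uptoS Hf)].
Qed.

Lemma differentiable_upto_sum (W : normedModType R) k (I : Type) (r : seq I)
    (P : pred I) (f : I -> V -> W) :
  (forall i, P i -> differentiable_upto k U (f i)) ->
  differentiable_upto k U (fun y => \sum_(i <- r | P i) f i y).
Proof.
move=> Hf; elim: r => [|i r IH].
  by apply: differentiable_upto_eq (differentiable_upto_cst k 0) => y _; rewrite big_nil.
pose g := if P i then fun y => f i y + \sum_(j <- r | P j) f j y
  else fun y => \sum_(j <- r | P j) f j y.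
apply: (@differentiable_upto_eq _ _ g).
  by move=> y _; rewrite /g big_cons; case: ifP.
by rewrite /g; case: ifP => // Pi; apply: differentiable_upto_add; auto.
Qed.

Lemma differentiable_upto_entry m n k (A : V -> 'M[R]_(m, n)) i j :
  differentiable_upto k U A -> differentiable_upto k U (fun y => A y i j).
Proof.
elim: k A => [//|k IH] A [dA DA]; split=> [x Ux|v].
  by apply: differentiable_entry; auto.
apply: differentiable_upto_eq (IH _ (DA v)) => y Uy.
by rewrite derive_entry //; auto.
Qed.

Lemma differentiable_upto_mx m n k (A : V -> 'M[R]_(m, n)) :
  (forall i j, differentiable_upto k U (fun y => A y i j)) ->
  differentiable_upto k U A.
Proof.
move=> HA.
apply: (@differentiable_upto_eq _ _ (fun y => \sum_i \sum_j A y i j *: delta_mx i j)).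
  by move=> y _; rewrite [RHS]matrix_sum_delta.
apply: differentiable_upto_sum => i _; apply: differentiable_upto_sum => j _.
apply: differentiable_upto_scale => //; exact: differentiable_upto_cst.
Qed.

(** By the chain rule the derivative of the composite is a sum of entries of ['D_v F] times partial
    derivatives of [g] along [F]. The latter fall under the induction hypothesis, which therefore
    quantifies over [g]. *)
Lemma differentiable_upto_comp (W : normedModType R) k m (U' : set 'rV[R]_m)
    (F : V -> 'rV[R]_m) (g : 'rV[R]_m -> W) :
  (forall y, U y -> U' (F y)) -> differentiable_upto k U F ->
  differentiable_upto k U' g -> differentiable_upto k U (fun y => g (F y)).
Proof.
move=> UU'; elim: k g => [//|k IH] g HF Hg.
have [[dF DF] [dg Dg]] := (HF, Hg); split=> [x Ux|v].
  by apply: (differentiable_comp (dF x Ux)); apply: dg; auto.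
apply: (@differentiable_upto_eq _ _
  (fun y => \sum_i 'D_v F y 0 i *: 'D_(delta_mx 0 i) g (F y))).
  move=> y Uy; rewrite [RHS]derive_comp; auto.
  rewrite [RHS]deriveE; auto.
  rewrite [in RHS](row_sum_delta ('D_v F y)) linear_sum.
  by apply: eq_bigr => i _; rewrite linearZ [in LHS](deriveE _ (dg _ (UU' _ Uy))).
apply: differentiable_upto_sum => i _; apply: differentiable_upto_scale.
  exact: differentiable_upto_entry (DF v).
exact: (IH ('D_(delta_mx 0 i) g) (differentiable_uptoS HF) (Dg _)).
Qed.

(** The derivative of [1/f] is built from [1/f] and ['D_v f], so each order follows from the
    previous one. *)
Lemma differentiable_upto_inv k (f : V -> R) :
  (forall y, U y -> f y != 0) -> differentiable_upto k U f ->
  differentiable_upto k U (fun y => (f y)^-1).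
Proof.
move=> f0; elim: k => [//|k IH] Hf; have [df Df] := Hf.
have Hi := IH (differentiable_uptoS Hf).
split=> [x Ux|v]; first by apply: differentiableV; auto.
apply: (@differentiable_upto_eq _ _ (fun y => (-1 * ((f y)^-1 * (f y)^-1)) * 'D_v f y)).
  move=> y Uy; rewrite [RHS]deriveV; [|by auto|by apply: diff_derivable; auto].
  by rewrite mulN1r -invfM -expr2.
apply: (@differentiable_upto_scale R); last exact: Df.
apply: (@differentiable_upto_scale R); first exact: differentiable_upto_cst.
exact: (@differentiable_upto_scale R).
Qed.

Lemma smooth_eq (W : normedModType R) (f g : V -> W) :
  (forall y, U y -> f y = g y) -> smooth_on U f -> smooth_on U g.
Proof. by move=> fg sf k; exact: differentiable_upto_eq (sf k). Qed.

Lemma smooth_differentiable (W : normedModType R) (f : V -> W) x :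
  smooth_on U f -> U x -> differentiable f x.
Proof. by move=> sf Ux; have [/(_ x Ux)] := sf 1%N. Qed.

Lemma smooth_derive (W : normedModType R) (f : V -> W) v :
  smooth_on U f -> smooth_on U ('D_v f).
Proof. by move=> sf k; have [_ /(_ v)] := sf k.+1. Qed.

Lemma smooth_cst (W : normedModType R) (c : W) : smooth_on U (fun _ : V => c).
Proof. by move=> k; exact: differentiable_upto_cst. Qed.

Lemma smooth_add (W : normedModType R) (f g : V -> W) :
  smooth_on U f -> smooth_on U g -> smooth_on U (fun y => f y + g y).
Proof. by move=> sf sg k; exact: differentiable_upto_add. Qed.

Lemma smooth_scale (W : normedModType R) (f : V -> R) (g : V -> W) :
  smooth_on U f -> smooth_on U g -> smooth_on U (fun y => f y *: g y).
Proof. by move=> sf sg k; exact: differentiable_upto_scale. Qed.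

Lemma smooth_mul (f g : V -> R) :
  smooth_on U f -> smooth_on U g -> smooth_on U (fun y => f y * g y).
Proof. exact: smooth_scale. Qed.

Lemma smooth_opp (W : normedModType R) (f : V -> W) :
  smooth_on U f -> smooth_on U (fun y => - f y).
Proof.
move=> sf; apply: (@smooth_eq _ (fun y => (-1) *: f y)).
  by move=> y _; rewrite scaleN1r.
by apply: smooth_scale => //; exact: smooth_cst.
Qed.

Lemma smooth_sum (W : normedModType R) (I : Type) (r : seq I)
    (P : pred I) (f : I -> V -> W) :
  (forall i, P i -> smooth_on U (f i)) ->
  smooth_on U (fun y => \sum_(i <- r | P i) f i y).
Proof. by move=> sf k; apply: differentiable_upto_sum => i Pi; exact: sf. Qed.

Lemma smooth_prod (I : Type) (r : seq I) (P : pred I) (f : I -> V -> R) :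
  (forall i, P i -> smooth_on U (f i)) ->
  smooth_on U (fun y => \prod_(i <- r | P i) f i y).
Proof.
move=> sf; elim: r => [|i r IH].
  by apply: smooth_eq (smooth_cst (1 : R)) => y _; rewrite big_nil.
case Pi: (P i); last by apply: smooth_eq IH => y _; rewrite big_cons Pi.
by apply: smooth_eq (smooth_mul (sf i Pi) IH) => y _; rewrite big_cons Pi.
Qed.

Lemma smooth_entry m n (A : V -> 'M[R]_(m, n)) i j :
  smooth_on U A -> smooth_on U (fun y => A y i j).
Proof. by move=> sA k; exact: differentiable_upto_entry. Qed.

Lemma smooth_mx m n (A : V -> 'M[R]_(m, n)) :
  (forall i j, smooth_on U (fun y => A y i j)) -> smooth_on U A.
Proof. by move=> sA k; apply: differentiable_upto_mx => i j; exact: sA. Qed.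

Lemma smooth_comp (W : normedModType R) m (U' : set 'rV[R]_m)
    (F : V -> 'rV[R]_m) (g : 'rV[R]_m -> W) :
  (forall y, U y -> U' (F y)) -> smooth_on U F ->
  smooth_on U' g -> smooth_on U (fun y => g (F y)).
Proof. by move=> UU' sF sg k; exact: (differentiable_upto_comp UU'). Qed.

Lemma smooth_inv (f : V -> R) :
  (forall y, U y -> f y != 0) -> smooth_on U f ->
  smooth_on U (fun y => (f y)^-1).
Proof. by move=> f0 sf k; exact: differentiable_upto_inv. Qed.

Lemma smooth_mulmx m n p (A : V -> 'M[R]_(m, n)) (B : V -> 'M[R]_(n, p)) :
  smooth_on U A -> smooth_on U B -> smooth_on U (fun y => A y *m B y).
Proof.
move=> sA sB; apply: smooth_mx => i j.
apply: (@smooth_eq _ (fun y => \sum_k A y i k * B y k j)).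
  by move=> y _; rewrite mxE.
by apply: smooth_sum => k _; apply: smooth_mul; exact: smooth_entry.
Qed.

Lemma smooth_trmx m n (A : V -> 'M[R]_(m, n)) :
  smooth_on U A -> smooth_on U (fun y => (A y)^T).
Proof.
move=> sA; apply: smooth_mx => i j.
by apply: smooth_eq (smooth_entry j i sA) => y _; rewrite mxE.
Qed.

Lemma smooth_det n (A : V -> 'M[R]_n) :
  (forall i j, smooth_on U (fun y => A y i j)) -> smooth_on U (fun y => \det (A y)).
Proof.
move=> sA; apply: smooth_sum => s _; apply: smooth_mul; first exact: smooth_cst.
by apply: smooth_prod => i _; exact: sA.
Qed.

(** Cramer's rule: the adjugate is polynomial in the entries of [A], and the determinant does not
    vanish on [U]. *)
Lemma smooth_invmx n (A : V -> 'M[R]_n) :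
  (forall y, U y -> A y \in unitmx) -> smooth_on U A ->
  smooth_on U (fun y => invmx (A y)).
Proof.
move=> uA sA; apply: (@smooth_eq _ (fun y => (\det (A y))^-1 *: \adj (A y))).
  by move=> y Uy; rewrite /invmx uA.
apply: smooth_scale.
  apply: smooth_inv; last by apply: smooth_det => i j; exact: smooth_entry.
  by move=> y Uy; have := uA y Uy; rewrite unitmxE unitfE.
apply: smooth_mx => i j.
apply: (@smooth_eq _ (fun y => (-1) ^+ (j + i) * \det (row' j (col' i (A y))))).
  by move=> y Uy; rewrite mxE.
apply: smooth_mul; first exact: smooth_cst.
apply: smooth_det => k l.
by apply: smooth_eq (smooth_entry (lift j k) (lift i l) sA) => y _; rewrite !mxE.
Qed.

End General.

End Smooth.

(** * Symmetry of second derivatives *)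

Section Schwarz.
Context {R : realType} {V : normedModType R}.

Lemma differentiable_line (v y : V) (s : R) :
  differentiable (fun s : R => s *: v + y) s /\ 'D_1 (fun s : R => s *: v + y) s = v.
Proof.
have dv : differentiable (fun _ : R => v) s := differentiable_cst _ _.
have dy : differentiable (fun _ : R => y) s := differentiable_cst _ _.
have did : differentiable (fun s : R => s) s by exact: ex_diff.
have [d1 d2] := diff_scale did dv.
split; first exact: (differentiableD d1 dy).
have -> : (fun s : R => s *: v + y) = (fun s : R => s *: v) + (fun _ => y) by [].
rewrite deriveD; [|exact: diff_derivable..].
by rewrite d2 !derive_cst derive_id scaler0 addr0 scale1r addr0.
Qed.

Lemma derive_line (f : V -> R) (v y : V) (s : R) :
  differentiable f (s *: v + y) ->
  differentiable (fun s : R => f (s *: v + y)) s /\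
  'D_1 (fun s : R => f (s *: v + y)) s = 'D_v f (s *: v + y).
Proof.
move=> df; have [d1 d2] := differentiable_line v y s.
split; first exact: (differentiable_comp d1 df).
by have := derive_comp (1 : R) d1 df; rewrite d2.
Qed.

Let second_difference (f : V -> R) (x v w : V) (t : R) :=
  f (t *: v + (t *: w + x)) - f (t *: v + x) - f (t *: w + x) + f x.

(* By the mean value theorem along [v] and differentiability of ['D_v f] at
   [x]; since the second difference is symmetric in [v] and [w], the two mixed
   derivatives agree. *)
Lemma second_difference_derive (U : set V) (f : V -> R) (x v w : V) :
  open U -> U x -> (forall y, U y -> differentiable f y) ->
  differentiable ('D_v f) x ->
  forall e : R, 0 < e -> \forall t \near 0^'+,
    `|second_difference f x v w t - t ^+ 2 * 'D_w ('D_v f) x| <= e * t ^+ 2.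
Proof.
move=> oU Ux df dG e e0; set G := 'D_v f; set L := 'd G x.
pose K := `|v| + `|w| + 1.
have K0 : 0 < K by rewrite /K; have := normr_ge0 v; have := normr_ge0 w; lra.
(* The relative error [e / (2 * K)] is used for two displacements of norm at most [t * K], so that
   the two errors add up to at most [e * t]. *)
have e'0 : 0 < e / (2 * K) by rewrite divr_gt0 // mulr_gt0.
have [d1 d10 hd1] : exists2 d, 0 < d & forall h, `|h| < d -> U (h + x).
  have /nbhs_ballP[d d0 hd] : nbhs x U by exact: open_nbhs_nbhs.
  exists d => // h hh; apply: hd; rewrite -ball_normE /=.
  by rewrite opprD addrCA subrr addr0 normrN.
have [d2 d20 hd2] : exists2 d, 0 < d &
    forall h, `|h| < d -> `|G (h + x) - (G x + L h)| <= e / (2 * K) * `|h|.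
  have [_ /eqaddoP ef] := (diff_locallyP _ _).1 dG.
  have /nbhs_ballP[d d0 hd] := ef _ e'0.
  exists d => // h hh; apply: hd; rewrite -ball_normE /=.
  by rewrite add0r normrN.
have t0 : \forall t \near 0^'+, (0:R) < t by exact: nbhs_right_gt.
have m0 : 0 < Num.min d1 d2 / K by rewrite divr_gt0 // lt_min d10.
near=> t.
have tpos : 0 < t by near: t.
have tK : t * K < Num.min d1 d2 by rewrite -ltr_pdivlMr //; near: t; exact: nbhs_right_lt.
have small s : s \in `[0, t] -> `|s *: v + t *: w| <= t * K /\ `|s *: v| <= t * K.
  rewrite in_itv /= => /andP[s0 st].
  have b1 : `|s *: v| <= t * `|v| by rewrite normrZ ger0_norm // ler_wpM2r.
  have b2 : `|t *: w| = t * `|w| by rewrite normrZ gtr0_norm.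
  split.
    apply: (le_trans (ler_normD _ _)); rewrite b2 /K !mulrDr; lra.
  by apply: (le_trans b1); rewrite /K !mulrDr; have := normr_ge0 w; nra.
pose g s := f (s *: v + (t *: w + x)) - f (s *: v + x).
have Us s : s \in `[0, t] -> U (s *: v + (t *: w + x)) /\ U (s *: v + x).
  move=> /small[b1 b2]; rewrite addrA; split; apply: hd1.
    by apply: (le_lt_trans b1); move: tK; rewrite lt_min => /andP[].
  by apply: (le_lt_trans b2); move: tK; rewrite lt_min => /andP[].
have dg s : s \in `[0, t] -> differentiable g s /\
    'D_1 g s = G (s *: v + (t *: w + x)) - G (s *: v + x).
  move=> /Us[U1 U2].
  have [a1 a2] := derive_line (df _ U1); have [b1 b2] := derive_line (df _ U2).
  split; first exact: differentiableB a1 b1.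
  have -> : g = (fun s => f (s *: v + (t *: w + x))) - (fun s => f (s *: v + x)) by [].
  by rewrite deriveB ?a2 ?b2 //; exact: diff_derivable.
have [||c cI hc] := @MVT R g ('D_1 g) 0 t tpos.
- move=> s /subset_itv_oo_cc sI.
  by apply: DeriveDef => //; apply: diff_derivable; exact: (dg s sI).1.
- apply: derivable_within_continuous => s sI.
  by apply: diff_derivable; exact: (dg s sI).1.
have cI' := subset_itv_oo_cc cI.
have -> : second_difference f x v w t = g t - g 0.
  by rewrite /second_difference /g !scale0r !add0r; lra.
rewrite hc (dg c cI').2 subr0.
have [b1 b2] := small c cI'.
have [m1 m2] : t * K < d1 /\ t * K < d2 by move: tK; rewrite lt_min => /andP[].
have h1 := hd2 _ (le_lt_trans b1 m2).
have h2 := hd2 _ (le_lt_trans b2 m2).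
rewrite addrA.
set A1 := G _ in h1 *; set A2 := G (c *: v + x) in h2 *.
rewrite deriveE // -/L.
have lin1 : L (c *: v + t *: w) = L (c *: v) + t * L w by rewrite linearD [in X in _ + X]linearZ.
rewrite lin1 in h1.
set l1 := L (c *: v) in h1 h2.
have -> : (A1 - A2) * t - t ^+ 2 * L w =
  t * ((A1 - (G x + (l1 + t * L w))) - (A2 - (G x + l1))) by ring.
rewrite normrM gtr0_norm // expr2 mulrCA ler_wpM2l ?(ltW tpos) //.
apply: (le_trans (ler_normB _ _)).
have h3 : e / (2 * K) * (t * K) = e * t / 2 by field; rewrite gt_eqF.
have e'0' := ltW e'0.
have := ler_wpM2l e'0' b1; have := ler_wpM2l e'0' b2.
rewrite h3; lra.
Unshelve. all: by end_near. Qed.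

Lemma derive_swap_real (U : set V) (f : V -> R) (x v w : V) :
  open U -> U x -> (forall y, U y -> differentiable f y) ->
  differentiable ('D_v f) x -> differentiable ('D_w f) x ->
  'D_w ('D_v f) x = 'D_v ('D_w f) x.
Proof.
have aux (D a b e t : R) : 0 < t -> `|D - t ^+ 2 * a| <= e / 2 * t ^+ 2 ->
    `|D - t ^+ 2 * b| <= e / 2 * t ^+ 2 -> `|a - b| <= e.
  move=> t0 h1 h2; have t20 : 0 < t ^+ 2 by rewrite exprn_gt0.
  rewrite -(ler_pM2l t20) -[X in X * `|_|]gtr0_norm // -normrM.
  have -> : t ^+ 2 * (a - b) = (D - t ^+ 2 * b) - (D - t ^+ 2 * a) by ring.
  by apply: (le_trans (ler_normB _ _)); move: h1 h2; lra.
move=> oU Ux df dv dw; apply/eqP; rewrite -subr_eq0 -normr_le0.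
apply/ler_addgt0Pr => e e0; rewrite add0r.
have e20 : 0 < e / 2 by lra.
have H1 := second_difference_derive w oU Ux df dv e20.
have H2 := second_difference_derive v oU Ux df dw e20.
have t0' : \forall t \near (0 : R)^'+, 0 < t by exact: nbhs_right_gt.
suff : \forall t \near (0 : R)^'+, `|'D_w ('D_v f) x - 'D_v ('D_w f) x| <= e.
  by move=> /filter_ex[].
move: H1 H2 t0'; apply: filterS3 => t h1 h2 t0.
have sym : second_difference f x w v t = second_difference f x v w t.
    by rewrite /second_difference [t *: w + (_ + _)]addrCA; congr (_ + _); exact: addrAC.
by rewrite sym in h2; exact: (aux _ _ _ _ _ t0 h1 h2).
Qed.

Lemma derive_swap m n (U : set V) (f : V -> 'M[R]_(m, n)) (x v w : V) :
  open U -> U x -> smooth_on U f -> 'D_w ('D_v f) x = 'D_v ('D_w f) x.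
Proof.
move=> oU Ux sf; apply/matrixP => i j.
have sD u : smooth_on U ('D_u f) by exact: smooth_derive.
have E u y : U y -> 'D_u f y i j = 'D_u (fun z => f z i j) y.
  by move=> Uy; rewrite derive_entry //; exact: smooth_differentiable Uy.
have E2 u u' : 'D_u ('D_u' f) x i j = 'D_u ('D_u' (fun z => f z i j)) x.
  rewrite derive_entry; last exact: (smooth_differentiable (sD _) Ux).
  by apply: near_eq_derive; exact: (near_open oU Ux (E u')).
apply: etrans (E2 w v) (etrans _ (esym (E2 v w))).
have se : smooth_on U (fun y => f y i j) by exact: smooth_entry.
apply: (derive_swap_real oU Ux).
- by move=> y Uy; exact: smooth_differentiable Uy.
- by apply: smooth_differentiable Ux; exact: smooth_derive.
- by apply: smooth_differentiable Ux; exact: smooth_derive.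
Qed.

End Schwarz.

(** * Christoffel symbols and curvature *)

Section Dot.
Context {R : realType} {n : nat}.
Implicit Types (A : 'M[R]_n) (X Y Z : 'rV[R]_n).

Definition posdef A := A^T = A /\ forall X, X != 0 -> 0 < dotm A X X.

Lemma dotmDl A X Y Z : dotm A (X + Y) Z = dotm A X Z + dotm A Y Z.
Proof. by rewrite /dotm !mulmxDl mxE. Qed.

Lemma dotmDr A X Y Z : dotm A X (Y + Z) = dotm A X Y + dotm A X Z.
Proof. by rewrite /dotm linearD /= mulmxDr mxE. Qed.

Lemma dotmZl A a X Y : dotm A (a *: X) Y = a * dotm A X Y.
Proof. by rewrite /dotm -!scalemxAl mxE. Qed.

Lemma dotmZr A a X Y : dotm A X (a *: Y) = a * dotm A X Y.
Proof. by rewrite /dotm linearZ /= -scalemxAr mxE. Qed.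

Lemma dotmNl A X Y : dotm A (- X) Y = - dotm A X Y.
Proof. by rewrite -scaleN1r dotmZl mulN1r. Qed.

Lemma dotmNr A X Y : dotm A X (- Y) = - dotm A X Y.
Proof. by rewrite -scaleN1r dotmZr mulN1r. Qed.

Lemma dotm0l A X : dotm A 0 X = 0.
Proof. by rewrite /dotm !mul0mx mxE. Qed.

Lemma dotm0r A X : dotm A X 0 = 0.
Proof. by rewrite /dotm trmx0 mulmx0 mxE. Qed.

Definition dotm_lin := (dotmDl, dotmDr, dotmZl, dotmZr, dotmNl, dotmNr).

Lemma dotm_suml A (I : Type) (r : seq I) (P : pred I) (F : I -> 'rV[R]_n) Y :
  dotm A (\sum_(i <- r | P i) F i) Y = \sum_(i <- r | P i) dotm A (F i) Y.
Proof.
by elim/big_rec2: _ => [|i a X _ IH]; rewrite ?dotm0l ?dotmDl ?IH.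
Qed.

Lemma dotm_sumr A (I : Type) (r : seq I) (P : pred I) (F : I -> 'rV[R]_n) X :
  dotm A X (\sum_(i <- r | P i) F i) = \sum_(i <- r | P i) dotm A X (F i).
Proof.
by elim/big_rec2: _ => [|i a Y _ IH]; rewrite ?dotm0r ?dotmDr ?IH.
Qed.

Lemma dotmC A X Y : A^T = A -> dotm A X Y = dotm A Y X.
Proof.
move=> sA; have tr (B : 'M[R]_1) : B^T 0 0 = B 0 0 by rewrite mxE.
by rewrite /dotm -[LHS]tr !trmx_mul trmxK sA mulmxA.
Qed.

Lemma dotm_sum A X Y : dotm A X Y = \sum_i \sum_j X 0 i * Y 0 j * A i j.
Proof.
rewrite /dotm mxE exchange_big; apply: eq_bigr => j _; rewrite !mxE big_distrl.
by apply: eq_bigr => i _ /=; rewrite mulrAC.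
Qed.

Lemma posdef_ge0 A X : posdef A -> 0 <= dotm A X X.
Proof.
by move=> [_ pA]; have [->|/pA/ltW//] := eqVneq X 0; rewrite dotm0l.
Qed.

Lemma posdef_eq0 A X : posdef A -> dotm A X X = 0 -> X = 0.
Proof.
by move=> [_ pA] h; apply/eqP/negPn/negP => /pA; rewrite h ltxx.
Qed.

Lemma posdef_inj A X Y : posdef A -> (forall Z, dotm A X Z = dotm A Y Z) -> X = Y.
Proof.
move=> pA h; apply/subr0_eq/(posdef_eq0 pA).
by rewrite dotmDl dotmNl h subrr.
Qed.

Lemma posdef_unitmx A : posdef A -> A \in unitmx.
Proof.
move=> pA; rewrite -row_free_unit -kermx_eq0; apply/eqP/row_matrixP => i.
rewrite row0; apply: (posdef_eq0 pA).
by rewrite /dotm -row_mul mulmx_ker row0 mul0mx mxE.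
Qed.

End Dot.

(** * The Levi-Civita connection of a metric in coordinates *)

Section Christoffel.
Context {R : realType} {m : nat} {U : set 'rV[R]_m} {h : 'rV[R]_m -> 'M[R]_m}.
Hypothesis oU : open U.
Hypothesis sh : smooth_on U h.
Hypothesis ph : forall x, U x -> posdef (h x).
Local Notation Gam := (christoffel_form h).

Lemma christoffel_form_linl x X X' Y c :
  Gam x (c *: X + X') Y = c *: Gam x X Y + Gam x X' Y.
Proof.
apply/rowP => k; rewrite !mxE big_distrr -big_split /=; apply: eq_bigr => i _.
rewrite big_distrr -big_split /=; apply: eq_bigr => j _; rewrite !mxE; ring.
Qed.

Lemma christoffel_form_linr x X Y Y' c :
  Gam x X (c *: Y + Y') = c *: Gam x X Y + Gam x X Y'.
Proof.
apply/rowP => k; rewrite !mxE big_distrr -big_split /=; apply: eq_bigr => i _.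
rewrite big_distrr -big_split /=; apply: eq_bigr => j _; rewrite !mxE; ring.
Qed.

Lemma christoffel_formDr x X Y Y' : Gam x X (Y + Y') = Gam x X Y + Gam x X Y'.
Proof. by have := christoffel_form_linr x X Y Y' 1; rewrite !scale1r. Qed.

Lemma derive_sum_dir (W : normedModType R) n (f : 'rV[R]_n -> W) x X :
  differentiable f x -> 'D_X f x = \sum_i X 0 i *: 'D_(delta_mx 0 i) f x.
Proof.
move=> df; rewrite deriveE // {1}(row_sum_delta X) linear_sum.
by apply: eq_bigr => i _; rewrite linearZ deriveE.
Qed.

Lemma differentiable_dotm (x Y Z : 'rV[R]_m) : U x ->
  differentiable (fun y => dotm (h y) Y Z) x.
Proof.
move=> Ux.
rewrite (_ : (fun y => _) = fun y => \sum_i \sum_j (Y 0 i * Z 0 j) *: h y i j); last first.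
  by apply/funext => y; rewrite dotm_sum.
apply: differentiable_sumf => i _; apply: differentiable_sumf => j _.
by apply: differentiableZ; apply: differentiable_entry; exact: smooth_differentiable Ux.
Qed.

Lemma derive_dotm_cst x X Y Z : U x ->
  'D_X (fun y => dotm (h y) Y Z) x =
  \sum_i \sum_j \sum_l X 0 i * Y 0 j * Z 0 l * partial i (fun y => h y j l) x.
Proof.
move=> Ux; rewrite derive_sum_dir; last exact: differentiable_dotm.
apply: eq_bigr => i _.
have dh j l : differentiable (fun y => h y j l) x.
  by apply: differentiable_entry; exact: smooth_differentiable Ux.
have dZ j l : differentiable (fun y => (Y 0 j * Z 0 l) *: h y j l) x.
  exact: differentiableZ.
rewrite (_ : (fun y => _) = fun y => \sum_i \sum_j (Y 0 i * Z 0 j) *: h y i j); last first.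
  by apply/funext => y; rewrite dotm_sum.
rewrite derive_sumf; last by move=> j _; apply: differentiable_sumf.
rewrite scaler_sumr; apply: eq_bigr => j _.
rewrite derive_sumf; last by [].
rewrite scaler_sumr; apply: eq_bigr => l _.
have -> : (fun y => (Y 0 j * Z 0 l) *: h y j l) = (Y 0 j * Z 0 l) \*: (fun y => h y j l) by [].
rewrite deriveZ; last exact: diff_derivable.
by rewrite scalerA /partial /GRing.scale /=; ring.
Qed.

(** Koszul's formula, free of bracket terms because the fields have constant components. It removes
    the inverse matrix from [christoffel]; symmetry and metric compatibility are then read off from
    it. *)
Lemma koszul x X Y Z : U x ->
  dotm (h x) (Gam x X Y) Z = 2^-1 * ('D_X (fun y => dotm (h y) Y Z) x +
    'D_Y (fun y => dotm (h y) X Z) x - 'D_Z (fun y => dotm (h y) X Y) x).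
Proof.
move=> Ux; rewrite !derive_dotm_cst //.
have [hT _] := ph Ux; have hu := posdef_unitmx (ph Ux).
(* Twice the Christoffel symbols of the first kind, as covectors. *)
pose c i j : 'rV[R]_m := \row_l (partial i (fun y => h y j l) x +
  partial j (fun y => h y i l) x - partial l (fun y => h y i j) x).
have -> : Gam x X Y = \sum_i \sum_j (2^-1 * (X 0 i * Y 0 j)) *: (c i j *m invmx (h x)).
  apply/rowP => k; rewrite !mxE summxE; apply: eq_bigr => i _.
  rewrite summxE; apply: eq_bigr => j _; rewrite !mxE /christoffel.
  rewrite [in RHS](eq_bigr (fun l => invmx (h x) k l *
    (partial i (fun y => h y j l) x + partial j (fun y => h y i l) x
     - partial l (fun y => h y i j) x))); first by ring.
  move=> l _; rewrite !mxE mulrC; congr (_ * _).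
  by rewrite -[in LHS]hT -trmx_inv mxE.
rewrite dotm_suml.
(* Renaming the summation indices here and in the next identity gives all three derivatives the
   weight [X 0 i * Y 0 j * Z 0 l]. *)
have -> : \sum_i \sum_j \sum_l Y 0 i * X 0 j * Z 0 l * partial i (fun y => h y j l) x =
  \sum_i \sum_j \sum_l X 0 i * Y 0 j * Z 0 l * partial j (fun y => h y i l) x.
  rewrite exchange_big; apply: eq_bigr => i _; apply: eq_bigr => j _.
  by apply: eq_bigr => l _; rewrite [Y 0 _ * _]mulrC.
have -> : \sum_i \sum_j \sum_l Z 0 i * X 0 j * Y 0 l * partial i (fun y => h y j l) x =
  \sum_i \sum_j \sum_l X 0 i * Y 0 j * Z 0 l * partial l (fun y => h y i j) x.
  rewrite exchange_big; apply: eq_bigr => i _.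
  rewrite exchange_big; apply: eq_bigr => j _; apply: eq_bigr => l _; ring.
rewrite -big_split -sumrB big_distrr /=; apply: eq_bigr => i _.
rewrite dotm_suml -big_split -sumrB big_distrr /=; apply: eq_bigr => j _.
rewrite dotmZl -mulrA; congr (_ * _).
rewrite /dotm -(mulmxA (c i j)) mulVmx // mulmx1 mxE big_distrr -big_split -sumrB /=.
by apply: eq_bigr => l _; rewrite !mxE; ring.
Qed.

Lemma dotm_cst_sym x X Y Z : U x ->
  'D_X (fun y => dotm (h y) Y Z) x = 'D_X (fun y => dotm (h y) Z Y) x.
Proof.
move=> Ux; apply: near_eq_derive; apply: (near_open oU Ux) => y Uy.
by rewrite dotmC //; have [] := ph Uy.
Qed.

Lemma christoffel_form_sym x X Y : U x -> Gam x X Y = Gam x Y X.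
Proof.
move=> Ux; apply: (posdef_inj (ph Ux)) => Z; rewrite !koszul //.
rewrite (dotm_cst_sym _ X Y Ux); ring.
Qed.

Lemma christoffel_form_metric x X Y Z : U x ->
  'D_X (fun y => dotm (h y) Y Z) x =
  dotm (h x) (Gam x X Y) Z + dotm (h x) Y (Gam x X Z).
Proof.
move=> Ux; rewrite [dotm _ Y _]dotmC; last by have [] := ph Ux.
rewrite !koszul // (dotm_cst_sym X Z Y Ux) (dotm_cst_sym Y X Z Ux).
by rewrite (dotm_cst_sym Z X Y Ux); field.
Qed.

Lemma smooth_christoffel_form X Y : smooth_on U (fun y => Gam y X Y).
Proof.
apply: (smooth_mx oU) => i k.
apply: (smooth_eq oU (f := fun y => \sum_i \sum_j christoffel h y k i j * X 0 i * Y 0 j)).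
  by move=> y _; rewrite mxE.
have sG a b : smooth_on U (fun y => christoffel h y k a b).
  apply: (smooth_mul oU); first exact: smooth_cst.
  apply: (smooth_sum oU) => l _; apply: (smooth_mul oU).
    apply: (smooth_entry oU); apply: (smooth_invmx oU) => // y Uy.
    by apply: posdef_unitmx; exact: ph.
  have sp a' b' c' : smooth_on U (partial a' (fun y => h y b' c')).
    by apply: (smooth_derive); exact: (smooth_entry oU).
  apply: (smooth_add oU); first exact: (smooth_add oU).
  exact: (smooth_opp oU).
apply: (smooth_sum oU) => a _; apply: (smooth_sum oU) => b _.
by do 2 (apply: (smooth_mul oU); last exact: smooth_cst).
Qed.

End Christoffel.

(** * Covariant derivatives along a map *)

Section Along.
Context {R : realType} {n m : nat} {U : set 'rV[R]_n} {W : set 'rV[R]_m}.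
Context {h : 'rV[R]_m -> 'M[R]_m} {F : 'rV[R]_n -> 'rV[R]_m}.
Hypothesis oU : open U.
Hypothesis oW : open W.
Hypothesis FUW : forall y, U y -> W (F y).
Hypothesis sF : smooth_on U F.
Hypothesis sh : smooth_on W h.
Hypothesis ph : forall z, W z -> posdef (h z).
Local Opaque derive christoffel_form dotm.
Local Notation Gam := (christoffel_form h).
Local Notation nab := (nabla_along h F).

Lemma nabla_alongE X V y : U y ->
  nab X V y = 'D_X V y + Gam (F y) ('D_X F y) (V y).
Proof.
by move=> Uy; rewrite /nabla_along (deriveEjacobian X (smooth_differentiable sF Uy)).
Qed.

Lemma nabla_along_eq X V V' y : U y -> (forall z, U z -> V z = V' z) ->
  nab X V y = nab X V' y.
Proof.
move=> Uy VV'; have nVV' : \near y, V y = V' y := near_open oU Uy VV'.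
by rewrite /nabla_along (VV' y Uy) (near_eq_derive X nVV').
Qed.

Lemma nabla_along_lin X V V' c y : U y -> differentiable V y -> differentiable V' y ->
  nab X (fun z => c *: V z + V' z) y = c *: nab X V y + nab X V' y.
Proof.
move=> Uy dV dV'; rewrite !nabla_alongE // christoffel_form_linr.
have -> : (fun z => c *: V z + V' z) = c \*: V + V' by [].
rewrite deriveD; [|apply: diff_derivable..] => //; last exact: differentiableZ.
rewrite deriveZ; last exact: diff_derivable.
by rewrite scalerDr addrACA.
Qed.

Local Opaque nabla_along.
(** The chain rule differentiates the coefficients of [h] in the direction ['D_X F y], and
    compatibility for constant fields turns this derivative into the two Christoffel terms. *)
Lemma diff_metric_along V Y y : U y -> differentiable V y -> differentiable Y y ->
  differentiable (fun z => dotm (h (F z)) (V z) (Y z)) y /\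
  forall X, 'D_X (fun z => dotm (h (F z)) (V z) (Y z)) y =
    dotm (h (F y)) (nab X V y) (Y y) + dotm (h (F y)) (V y) (nab X Y y).
Proof.
move=> Uy dV dY; have Wy := FUW Uy.
have dF : differentiable F y := smooth_differentiable sF Uy.
pose B z (s w : 'rV[R]_m) : R := dotm (h (F z)) s w.
have [|||d1 d2] := @diff_bilin_family _ _ R m m B V Y y _ _ _ dV dY.
- by move=> z s s' c w; rewrite /B dotmDl dotmZl.
- by move=> z s s' c w; rewrite /B dotmDr dotmZr.
- by move=> s w; exact: (differentiable_comp dF (differentiable_dotm sh s w Wy)).
split=> // X; rewrite d2 /B.
have dd := differentiable_dotm sh (V y) (Y y) Wy.
rewrite (derive_comp X dF dd) (christoffel_form_metric oW sh ph) //.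
rewrite !nabla_alongE // !(dotmDl, dotmDr).
by rewrite -addrA addrACA [X in X + _]addrC [X in _ + X]addrC.
Qed.

Lemma diff_christoffel_along V Y y : U y -> differentiable V y -> differentiable Y y ->
  differentiable (fun z => Gam (F z) (V z) (Y z)) y /\
  forall X, 'D_X (fun z => Gam (F z) (V z) (Y z)) y =
    'D_('D_X F y) (fun z => Gam z (V y) (Y y)) (F y) + Gam (F y) ('D_X V y) (Y y) +
    Gam (F y) (V y) ('D_X Y y).
Proof.
move=> Uy dV dY; have Wy := FUW Uy.
have dF : differentiable F y := smooth_differentiable sF Uy.
have dG s w : differentiable (fun z => Gam z s w) (F y).
  by apply: smooth_differentiable Wy; exact: (smooth_christoffel_form oW sh ph).
pose B z (s w : 'rV[R]_m) := Gam (F z) s w.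
have [|||d1 d2] := @diff_bilin_family _ _ _ m m B V Y y _ _ _ dV dY.
- by move=> z s s' c w; rewrite /B christoffel_form_linl.
- by move=> z s s' c w; rewrite /B christoffel_form_linr.
- by move=> s w; exact: (differentiable_comp dF (dG s w)).
split; first exact: d1.
move=> X.
rewrite d2 /B.
have dd := dG (V y) (Y y).
by rewrite (derive_comp X dF dd).
Qed.

Lemma differentiable_nabla_along X V y : U y -> smooth_on U V ->
  differentiable (nab X V) y.
Proof.
move=> Uy sV.
apply: (@near_eq_differentiable _ _ _
    (fun z => 'D_X V z + Gam (F z) ('D_X F z) (V z))).
  by apply: (near_open oU Uy) => z Uz; rewrite nabla_alongE.
apply: differentiableD.
  by apply: smooth_differentiable Uy; exact: smooth_derive.
apply: (diff_christoffel_along Uy _ _).1; last exact: (smooth_differentiable _ Uy).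
by apply: smooth_differentiable Uy; exact: smooth_derive.
Qed.

(** Vanishing torsion: the second derivatives of [F] commute and the Christoffel form is
    symmetric. *)
Lemma nabla_along_sym X Y y : U y -> nab X ('D_Y F) y = nab Y ('D_X F) y.
Proof.
move=> Uy; rewrite (nabla_alongE X _ Uy) (nabla_alongE Y _ Uy).
rewrite (derive_swap Y X oU Uy sF).
by rewrite (christoffel_form_sym oW sh ph _ _ (FUW Uy)).
Qed.

Lemma curvatureE z X Y Z : curvature h z X Y Z =
  ('D_X (fun z => Gam z Y Z) z + Gam z X (Gam z Y Z)) -
  ('D_Y (fun z => Gam z X Z) z + Gam z Y (Gam z X Z)).
Proof.
have E A B : nabla h A (cst B) = fun z => Gam z A B.
  by apply/funext => y; rewrite /nabla derive_cst add0r.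
by rewrite /curvature !E.
Qed.

(** The curvature of the pulled-back connection is the pulled-back curvature; constant [X] and [Y]
    commute, so no bracket term arises. *)
Lemma nabla_along_curvature X Y V x : U x -> smooth_on U V ->
  nab X (nab Y V) x - nab Y (nab X V) x =
  curvature h (F x) ('D_X F x) ('D_Y F x) (V x).
Proof.
move=> Ux sV; rewrite curvatureE.
have E A B : nab A (nab B V) x =
   'D_A ('D_B V) x + ('D_('D_A F x) (fun z => Gam z ('D_B F x) (V x)) (F x) +
     Gam (F x) ('D_A ('D_B F) x) (V x) + Gam (F x) ('D_B F x) ('D_A V x)) +
   (Gam (F x) ('D_A F x) ('D_B V x) +
    Gam (F x) ('D_A F x) (Gam (F x) ('D_B F x) (V x))).
  have dBV : differentiable ('D_B V) x.
    by apply: smooth_differentiable Ux; exact: smooth_derive.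
  have dBF : differentiable ('D_B F) x.
    by apply: smooth_differentiable Ux; exact: smooth_derive.
  have dV : differentiable V x := smooth_differentiable sV Ux.
  have [d1 d2] := diff_christoffel_along Ux dBF dV.
  rewrite (@nabla_along_eq A _ (fun z => 'D_B V z + Gam (F z) ('D_B F z) (V z)) x Ux);
    last by move=> z Uz; rewrite (nabla_alongE B _ Uz).
  rewrite (nabla_alongE A _ Ux) christoffel_formDr; congr (_ + _).
  have -> : (fun z => 'D_B V z + Gam (F z) ('D_B F z) (V z)) =
    'D_B V + (fun z => Gam (F z) ('D_B F z) (V z)) by [].
  rewrite deriveD; [by rewrite d2|exact: diff_derivable|exact: diff_derivable].
rewrite (E X Y) (E Y X) (derive_swap Y X oU Ux sV) (derive_swap Y X oU Ux sF).
(* Here [a] and [b] stem from the commuting second derivatives of [V] and [F]; the cross terms [c1],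
   [c2] reappear in the other order when [X] and [Y] are exchanged. *)
have aux (a b c1 c2 p1 p2 q1 q2 : 'rV[R]_m) :
  a + (p1 + b + c1) + (c2 + q1) - (a + (p2 + b + c2) + (c1 + q2)) =
  p1 + q1 - (p2 + q2).
  by apply/rowP => i; rewrite !mxE; ring.
exact: aux.
Qed.

End Along.

(** * Algebraic curvature tensors of Kaehler type *)

Section KaehlerAlgebra.
Context {R : realFieldType} {V : zmodType}.
Variables (T : V -> V -> V -> V -> R) (J : V -> V).
Hypothesis TD1 : forall x x' y z t, T (x + x') y z t = T x y z t + T x' y z t.
Hypothesis TD2 : forall x y y' z t, T x (y + y') z t = T x y z t + T x y' z t.
Hypothesis TD3 : forall x y z z' t, T x y (z + z') t = T x y z t + T x y z' t.
Hypothesis TD4 : forall x y z t t', T x y z (t + t') = T x y z t + T x y z t'.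
Hypothesis JD : forall x y, J (x + y) = J x + J y.
Hypothesis JJ : forall x, J (J x) = - x.
Hypothesis T12 : forall x y z t, T x y z t = - T y x z t.
Hypothesis T34 : forall x y z t, T x y z t = - T x y t z.
Hypothesis bianchi : forall x y z t, T x y z t + T y z x t + T z x y t = 0.
Hypothesis TJ : forall x y z t, T x y (J z) (J t) = T x y z t.

Let TN1 x y z t : T (- x) y z t = - T x y z t.
Proof.
have T0 : T 0 y z t = 0 by have := TD1 0 0 y z t; rewrite addr0; lra.
by have := TD1 x (- x) y z t; rewrite subrr T0; lra.
Qed.
Let TN2 x y z t : T x (- y) z t = - T x y z t.
Proof. by rewrite T12 TN1 -T12. Qed.
Let TN4 x y z t : T x y z (- t) = - T x y z t.
Proof.
have T0 : T x y z 0 = 0 by have := TD4 x y z 0 0; rewrite addr0; lra.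
by have := TD4 x y z t (- t); rewrite subrr T0; lra.
Qed.
Let TN3 x y z t : T x y (- z) t = - T x y z t.
Proof. by rewrite T34 TN4 -T34. Qed.
Let JN x : J (- x) = - J x.
Proof.
have J0 : J 0 = 0 by apply: (addrI (J 0)); rewrite -JD !addr0.
by apply: (addrI (J x)); rewrite -JD !subrr J0.
Qed.

(** The four cyclic instances of the Bianchi identity on [x, y, z, t] combine, through the two
    skew-symmetries, into the exchange of the pairs. *)
Let Tpair x y z t : T x y z t = T z t x y.
Proof.
have b1 := bianchi x y z t; have b2 := bianchi y z t x.
have b3 := bianchi z t x y; have b4 := bianchi t x y z.
rewrite (T34 y z x t) (T34 z x y t) in b1.
rewrite (T34 z t y x) (T12 t y z x) in b2.
rewrite (T12 t x z y) (T34 x t z y) (T12 x z t y) in b3.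
rewrite (T34 x y t z) (T12 y t x z) in b4.
have := T34 y z t x; have := T34 z t x y; have := T34 t x y z; have := T34 x y z t.
have := T12 z x t y; have := T12 y t z x; have := T34 x z t y; have := T34 y t z x.
have := T12 x t y z; have := T12 t x y z; have := T12 t x z y.
have := T34 x t y z; have := T34 t y x z; have := T34 z x t y.
have := T12 y t x z; have := T12 z x y t; have := T34 x z y t; have := T12 t y x z.
have := T12 x z y t; have := T12 x z t y; have := T12 t y z x.
lra.
Qed.

Let TJ12 x y z t : T (J x) (J y) z t = T x y z t.
Proof. by rewrite Tpair TJ -Tpair. Qed.

Let K x y := T x y y x.
Let Q x := T x (J x) (J x) x.

Let KJ x y : K (J x) y = K x (J y).
Proof.
rewrite /K -[LHS]TJ -[LHS]TJ12 !JJ !(TN1, TN2, TN3, TN4); lra.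
Qed.

(* Eliminating [K x (J y)] between this identity for [(x, y)] and for [(x, J y)]
   expresses the sectional curvature [K x y] by holomorphic ones. *)
Let polar x y : Q (x + y) + Q (x - y) =
  2 * Q x + 2 * Q y + 4 * K x y + 12 * K x (J y).
Proof.
rewrite /Q /K !JD JN.
rewrite !(TD1, TD2, TD3, TD4) !(TN1, TN2, TN3, TN4).
have P1 : T y (J y) (J x) x = T x (J x) (J y) y.
  by rewrite Tpair T12 T34 opprK.
have e1 u v : T u (J v) (J u) v = T u (J v) (J v) u.
  by rewrite -[LHS]TJ JJ TN3 -T34.
have e2 : T y (J x) (J x) y = T x (J y) (J y) x.
  by have := KJ x y; rewrite /K => <-; rewrite T12 T34 opprK.
(* By Bianchi's identity the bisectional curvature of the holomorphic planes of [x] and [y] is a sum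
   of two sectional terms. *)
have P2 : T x (J x) (J y) y = T x y y x + T x (J y) (J y) x.
  have := bianchi x (J x) (J y) y.
  rewrite TJ12 (T34 x y x y) (T12 (J y) x (J x) y).
  by have := e1 x y; rewrite -[T x (J y) (J x) y]TJ12; lra.
have f1 := e1 x y; have f2 := e1 y x.
lra.
Qed.

(** Polarisation involves only sums and differences, so additivity takes the place of linearity
    throughout. *)
Lemma sectional_of_holomorphic (q : V -> V -> R) (c : R) :
  (forall x x' y, q (x + x') y = q x y + q x' y) ->
  (forall x y, q x y = q y x) -> (forall x y, q (J x) (J y) = q x y) ->
  (forall x, T x (J x) (J x) x = c * q x x ^+ 2) ->
  forall x y, T x y y x =
    c / 4 * (q x x * q y y - q x y ^+ 2 + 3 * q x (J y) ^+ 2).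
Proof.
move=> qD qC qJ hQ x y; rewrite -/(K x y).
have qDr u v w : q u (v + w) = q u v + q u w by rewrite qC qD !(qC u).
have qN u v : q (- u) v = - q u v.
  have q0 : q 0 v = 0 by have := qD 0 0 v; rewrite addr0; lra.
  by have := qD u (- u) v; rewrite subrr q0; lra.
have qNr u v : q u (- v) = - q u v by rewrite qC qN qC.
have p1 := polar x y; have p2 := polar x (J y).
rewrite /K JJ TN2 TN3 opprK -!/(K _ _) in p2.
have QE u : Q u = c * q u u ^+ 2 by exact: hQ.
rewrite !QE !(qD, qDr, qN, qNr) in p1.
rewrite !QE !(qD, qDr, qN, qNr) qJ in p2.
rewrite (qC y x) in p1; rewrite (qC (J y) x) in p2.
move: p1 p2; set s := q x y; set t := q x (J y); set a := q x x; set b := q y y.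
set k1 := K x y; set k2 := K x (J y) => p1 p2.
(* The two polar identities give [4 * k1 + 12 * k2] and [12 * k1 + 4 * k2]; three times the second
   minus the first is [32 * k1]. *)
have -> : k1 = (3 * (2 * k2 * 2 + 12 * k1) - (4 * k1 + 12 * k2)) / 32 by field.
have -> : 4 * k1 + 12 * k2 = c * (a + s + (s + b)) ^+ 2 + c * (a - s - (s - b)) ^+ 2
  - 2 * (c * a ^+ 2) - 2 * (c * b ^+ 2) by lra.
have -> : 2 * k2 * 2 + 12 * k1 = c * (a + t + (t + b)) ^+ 2 + c * (a - t - (t - b)) ^+ 2
  - 2 * (c * a ^+ 2) - 2 * (c * b ^+ 2) by lra.
by field.
Qed.

End KaehlerAlgebra.

Lemma derive_dir_lin (R : realType) (V W : normedModType R) (f : V -> W) x c X X' :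
  differentiable f x -> 'D_(c *: X + X') f x = c *: 'D_X f x + 'D_X' f x.
Proof. by move=> df; rewrite !(deriveE _ df) linearD linearZ. Qed.

(** * Curvature of the ambient manifold *)

Section Ambient.
Context {R : realType} {m : nat} {W : set 'rV[R]_m} {h : 'rV[R]_m -> 'M[R]_m}.
Hypothesis oW : open W.
Hypothesis sh : smooth_on W h.
Hypothesis ph : forall z, W z -> posdef (h z).
Local Notation Gam := (christoffel_form h).
Local Notation nab := (nabla_along h id).
Local Notation Rm := (curvature h).
Local Opaque derive christoffel_form nabla_along dotm curvature.

(** Taking the identity as the map makes the results on fields along a map available for the ambient
    connection. *)
Lemma smooth_id : smooth_on W (id : 'rV[R]_m -> 'rV[R]_m).
Proof.
case=> [//|k]; split=> [x _|v]; first exact: ex_diff.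
apply: (@differentiable_upto_eq _ _ _ oW _ k (fun _ => v)).
  by move=> y _; rewrite derive_id.
exact: (differentiable_upto_cst oW).
Qed.

Let WW : forall z, W z -> W (id z). Proof. by []. Qed.

Lemma nabla_id_cst X Z z : W z -> nab X (cst Z) z = Gam z X Z.
Proof. by move=> Wz; rewrite (nabla_alongE smooth_id X (cst Z) Wz) derive_cst derive_id add0r. Qed.

Lemma curvature_nabla X Y V z : W z -> smooth_on W V ->
  Rm z X Y (V z) = nab X (nab Y V) z - nab Y (nab X V) z.
Proof.
move=> Wz sV; rewrite (nabla_along_curvature oW oW WW smooth_id sh ph X Y Wz sV).
by rewrite !derive_id.
Qed.

Lemma curvature_nabla_cst X Y Z z : W z ->
  Rm z X Y Z = nab X (nab Y (cst Z)) z - nab Y (nab X (cst Z)) z.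
Proof. by move=> Wz; rewrite -(curvature_nabla X Y Wz (smooth_cst oW Z)). Qed.

Lemma curvature12 X Y Z z : Rm z X Y Z = - Rm z Y X Z.
Proof. by rewrite !curvatureE opprB. Qed.

Lemma curvature_lin1 X X' Y Z z c : W z ->
  Rm z (c *: X + X') Y Z = c *: Rm z X Y Z + Rm z X' Y Z.
Proof.
move=> Wz; rewrite !curvatureE.
have dG A B : differentiable (fun z => Gam z A B) z.
  exact: (smooth_differentiable (smooth_christoffel_form oW sh ph A B) Wz).
rewrite (derive_dir_lin c X X' (dG Y Z)).
have -> : (fun z => Gam z (c *: X + X') Z) =
    (c \*: (fun z => Gam z X Z)) + (fun z => Gam z X' Z).
  by apply/funext => y; rewrite christoffel_form_linl.
rewrite deriveD; [|by apply: derivableZ; exact: diff_derivable|exact: diff_derivable].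
rewrite deriveZ; last exact: diff_derivable.
rewrite !christoffel_form_linl christoffel_form_linr.
have aux (k : R) (a a' b b' e e' f f' : 'rV[R]_m) :
  k *: a + a' + (k *: b + b') - (k *: e + e' + (k *: f + f')) =
  k *: (a + b - (e + f)) + (a' + b' - (e' + f')).
  by apply/rowP => i; rewrite !mxE; ring.
exact: aux.
Qed.

Lemma curvature_lin3 X Y Z Z' z c : W z ->
  Rm z X Y (c *: Z + Z') = c *: Rm z X Y Z + Rm z X Y Z'.
Proof.
move=> Wz; rewrite !curvatureE.
have dG A B : differentiable (fun z => Gam z A B) z.
  exact: (smooth_differentiable (smooth_christoffel_form oW sh ph A B) Wz).
have E A B : 'D_A (fun z => Gam z B (c *: Z + Z')) z =
    c *: 'D_A (fun z => Gam z B Z) z + 'D_A (fun z => Gam z B Z') z.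
  have -> : (fun z => Gam z B (c *: Z + Z')) =
    (c \*: (fun z => Gam z B Z)) + (fun z => Gam z B Z').
    by apply/funext => y; rewrite christoffel_form_linr.
  rewrite deriveD; [|by apply: derivableZ; exact: diff_derivable|exact: diff_derivable].
  by rewrite deriveZ; last exact: diff_derivable.
rewrite (E X Y) (E Y X) !christoffel_form_linr.
have aux (k : R) (a a' b b' e e' f f' : 'rV[R]_m) :
  k *: a + a' + (k *: b + b') - (k *: e + e' + (k *: f + f')) =
  k *: (a + b - (e + f)) + (a' + b' - (e' + f')).
  by apply/rowP => i; rewrite !mxE; ring.
exact: aux.
Qed.

(** The function [<Z, T>] has commuting second derivatives. When both are expanded by metric
    compatibility, the products of first covariant derivatives cancel and the two curvature terms
    remain. *)
Lemma curvature34 X Y Z T z : W z ->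
  dotm (h z) (Rm z X Y Z) T = - dotm (h z) (Rm z X Y T) Z.
Proof.
move=> Wz; pose f y := dotm (h y) Z T.
have met V V' y (Wy : W y) (dV : differentiable V y) (dV' : differentiable V' y) :=
  diff_metric_along oW WW smooth_id sh ph Wy dV dV'.
have sc (Z0 : 'rV[R]_m) := smooth_cst oW Z0.
have dc (Z0 y : 'rV[R]_m) : differentiable (cst Z0) y := differentiable_cst _ _.
have dn A B y (Wy : W y) := differentiable_nabla_along oW oW WW smooth_id sh ph A Wy (sc B).
have D1 A y : W y -> 'D_A f y = dotm (h y) (nab A (cst Z) y) T + dotm (h y) Z (nab A (cst T) y).
  by move=> Wy; exact: ((met _ _ _ Wy (dc Z y) (dc T y)).2 A).
have D2 A B : 'D_A ('D_B f) z =
  (dotm (h z) (nab A (nab B (cst Z)) z) T + dotm (h z) (nab B (cst Z) z) (nab A (cst T) z)) +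
  (dotm (h z) (nab A (cst Z) z) (nab B (cst T) z) + dotm (h z) Z (nab A (nab B (cst T)) z)).
  have nD : \near z, 'D_B f z = dotm (h z) (nab B (cst Z) z) T + dotm (h z) Z (nab B (cst T) z).
    exact: (near_open oW Wz (D1 B)).
  rewrite (near_eq_derive A nD).
  have [d1 e1] := met _ _ _ Wz (dn B Z z Wz) (dc T z).
  have [d2 e2] := met _ _ _ Wz (dc Z z) (dn B T z Wz).
  have -> : (fun y => dotm (h y) (nab B (cst Z) y) T + dotm (h y) Z (nab B (cst T) y)) =
    (fun y => dotm (h y) (nab B (cst Z) y) T) + (fun y => dotm (h y) Z (nab B (cst T) y)) by [].
  rewrite deriveD; [|exact: diff_derivable|exact: diff_derivable].
  by congr (_ + _); [exact: e1|exact: e2].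
have sf : smooth_on W f.
  have e : forall y, W y -> ((Z *m h y *m T^T) 0 0) = f y by [].
  apply: (smooth_eq oW e); apply: (smooth_entry oW).
  apply: (smooth_mulmx oW); last exact: smooth_cst.
  by apply: (smooth_mulmx oW); first exact: smooth_cst.
have := derive_swap_real oW Wz (fun y Wy => smooth_differentiable sf Wy)
  (smooth_differentiable (smooth_derive Y sf) Wz)
  (smooth_differentiable (smooth_derive X sf) Wz).
have sz := (ph Wz).1.
have E1 T0 Z0 : dotm (h z) (Rm z X Y Z0) T0 =
    dotm (h z) (nab X (nab Y (cst Z0)) z) T0 - dotm (h z) (nab Y (nab X (cst Z0)) z) T0.
  rewrite (curvature_nabla_cst X Y Z0 Wz).
  by rewrite (dotmDl _ (nab X (nab Y (cst Z0)) z)) dotmNl.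
rewrite (D2 X Y) (D2 Y X) (E1 T Z) (E1 Z T).
rewrite (dotmC Z (nab X (nab Y (cst T)) z) sz) (dotmC Z (nab Y (nab X (cst T)) z) sz).
have aux (a1 a2 a3 a4 b1 b4 : R) : a1 + a2 + (a3 + a4) = b1 + a3 + (a2 + b4) ->
  a1 - b1 = - (a4 - b4) by lra.
exact: aux.
Qed.

(** Vanishing torsion makes [nab B (cst C)] symmetric in [B] and [C], so the six second derivatives
    cancel in pairs. *)
Lemma curvature_bianchi X Y Z z : W z ->
  Rm z X Y Z + Rm z Y Z X + Rm z Z X Y = 0.
Proof.
move=> Wz; rewrite !(curvature_nabla_cst _ _ _ Wz).
have E A B C : nab A (nab B (cst C)) z = nab A (nab C (cst B)) z.
  apply: (@nabla_along_eq R m m W h id oW A (nab B (cst C)) (nab C (cst B)) z Wz) => y Wy.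
  by rewrite !nabla_id_cst // (christoffel_form_sym oW sh ph _ _ Wy).
rewrite (E X Z Y) (E Y X Z) (E Z Y X).
have aux (a b c : 'rV[R]_m) : a - b + (b - c) + (c - a) = 0.
  by apply/rowP => i; rewrite !mxE; ring.
exact: aux.
Qed.

Section Parallel.
Context {J : 'rV[R]_m -> 'M[R]_m}.
Hypothesis sJ : smooth_on W J.
Hypothesis pJ : forall z, W z -> parallel_at h (fun y Y => Y *m J y) z.

(** [parallel_at] tests constant fields; the Leibniz rule extends it to differentiable fields along
    a map. *)
Lemma nabla_along_J n (U : set 'rV[R]_n) (F : 'rV[R]_n -> 'rV[R]_m) X V y :
  open U -> (forall y, U y -> W (F y)) -> smooth_on U F -> U y -> differentiable V y ->
  differentiable (fun y => V y *m J (F y)) y /\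
  nabla_along h F X (fun y => V y *m J (F y)) y = nabla_along h F X V y *m J (F y).
Proof.
move=> oU FUW sF Uy dV; have Wy := FUW _ Uy.
have dF := smooth_differentiable sF Uy.
have dJ (s : 'rV[R]_m) : differentiable (fun z => s *m J z) (F y).
  apply: (smooth_differentiable (U := W)) => //.
  by apply: (smooth_mulmx oW) => //; exact: smooth_cst.
pose L y (s : 'rV[R]_m) := s *m J (F y).
have [||d1 d2] := @diff_lin_family _ _ _ _ L V y _ _ dV.
- by move=> z s s' c; rewrite /L mulmxDl scalemxAl.
- by move=> s; exact: (differentiable_comp dF (dJ s)).
split; first exact: d1.
rewrite (nabla_alongE sF X V Uy) (nabla_alongE sF X _ Uy) d2 /L (derive_comp X dF (dJ (V y))).
have := pJ Wy ('D_X F y) (V y); rewrite /nabla derive_cst add0r => e.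
rewrite mulmxDl -e.
by rewrite [RHS]addrC addrAC.
Qed.

(** [J] commutes with each covariant derivative, hence with their commutator. *)
Lemma curvatureJ X Y Z z : W z -> Rm z X Y (Z *m J z) = Rm z X Y Z *m J z.
Proof.
move=> Wz.
have sZJ : smooth_on W (fun y => Z *m J y).
  by apply: (smooth_mulmx oW) => //; exact: smooth_cst.
have dc (y : 'rV[R]_m) : differentiable (cst Z) y := differentiable_cst _ _.
rewrite (curvature_nabla X Y Wz sZJ) (curvature_nabla_cst X Y Z Wz) mulmxBl.
have sc := smooth_cst oW Z.
have E A B : nab A (nab B (fun y => Z *m J y)) z = nab A (nab B (cst Z)) z *m J z.
  rewrite (nabla_along_eq oW A Wz (V' := fun y => nab B (cst Z) y *m J y)); last first.
    by move=> y Wy; exact: (nabla_along_J B oW WW smooth_id Wy (dc y)).2.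
  apply: (nabla_along_J A oW WW smooth_id Wz _).2.
  exact: (differentiable_nabla_along oW oW WW smooth_id sh ph B Wz sc).
by rewrite (E X Y) (E Y X).
Qed.

Hypothesis JJ : forall z, W z -> J z *m J z = - 1%:M.
Hypothesis hJ : forall z, W z -> forall X Y, dotm (h z) (X *m J z) (Y *m J z) = dotm (h z) X Y.

Lemma dotmJ z X : W z -> dotm (h z) X (X *m J z) = 0.
Proof.
move=> Wz; have := hJ Wz X (X *m J z).
rewrite -mulmxA JJ // mulmxN mulmx1 dotmNr (dotmC (X *m J z)); last exact: (ph Wz).1.
by lra.
Qed.

Lemma curvature_complex_space_form c z X Y : W z ->
  (forall X, X != 0 -> sectional h z X (X *m J z) = c) ->
  dotm (h z) (Rm z X Y Y) X = c / 4 * (dotm (h z) X X * dotm (h z) Y Y -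
    dotm (h z) X Y ^+ 2 + 3 * dotm (h z) X (Y *m J z) ^+ 2).
Proof.
move=> Wz hc; have pz := ph Wz; have sz := pz.1.
pose T X Y Z V := dotm (h z) (Rm z X Y Z) V.
have add1 A A' B C : Rm z (A + A') B C = Rm z A B C + Rm z A' B C.
  by have := curvature_lin1 A A' B C 1 Wz; rewrite !scale1r.
have add3 A B C C' : Rm z A B (C + C') = Rm z A B C + Rm z A B C'.
  by have := curvature_lin3 A B C C' 1 Wz; rewrite !scale1r.
(* For nonzero [x] the denominator of the sectional curvature is the square of [<x, x>], as [J] is
   isometric and [J x] is orthogonal to [x]; zero is treated apart. *)
have hq : forall x, T x (x *m J z) (x *m J z) x = c * dotm (h z) x x ^+ 2.
  move=> x; have [->|x0] := eqVneq x 0; first by rewrite /T !dotm0r; ring.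
  have x1 : dotm (h z) x x != 0 by rewrite gt_eqF //; exact: pz.2.
  rewrite -(hc x x0) /sectional hJ // dotmJ //.
  rewrite -expr2 expr0n /= subr0 mulfVK //; by rewrite expf_neq0.
apply: (@sectional_of_holomorphic _ _ T (fun v => v *m J z) _ _ _ _ _ _ _ _ _ _
  (dotm (h z)) c _ _ _ hq).
- by move=> *; rewrite /T add1 dotmDl.
- by move=> x y y' *; rewrite /T curvature12 add1 dotmNl dotmDl opprD -!dotmNl -!curvature12.
- by move=> *; rewrite /T add3 dotmDl.
- by move=> *; rewrite /T dotmDr.
- by move=> *; rewrite mulmxDl.
- by move=> x; rewrite -mulmxA JJ // mulmxN mulmx1.
- by move=> *; rewrite /T curvature12 dotmNl.
- by move=> *; exact: curvature34.
- by move=> *; rewrite /T -!dotmDl curvature_bianchi // dotm0l.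
- by move=> *; rewrite /T curvatureJ // hJ.
- by move=> *; rewrite dotmDl.
- by move=> *; exact: dotmC.
- by move=> *; exact: hJ.
Qed.

End Parallel.
End Ambient.

(** * Gauss equation and the cubic form of a slant immersion *)

Section Immersion.
Context {R : realType} {n m : nat} {U : set 'rV[R]_n} {W : set 'rV[R]_m}.
Context {S : local_immersion R n m}.
Local Notation h := (amb_metric S).
Local Notation J := (amb_J S).
Local Notation g := (induced_metric S).
Hypothesis oU : open U.
Hypothesis oW : open W.
Hypothesis UW : forall y, U y -> W (S y).
Hypothesis sS : smooth_on U S.
Hypothesis sh : smooth_on W h.
Hypothesis ph : forall z, W z -> posdef (h z).
Hypothesis rS : forall y, U y -> row_free ('J S y).
Local Notation nab := (nabla_along h S).
Local Notation Gg := (christoffel_form g).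
Local Notation "x ⋅[ y ] z" := (dotm (h (S y)) x z) (at level 40, y at level 0).
Local Opaque derive.

Lemma dotm_induced y X Y : dotm (g y) X Y = (X *m 'J S y) ⋅[y] (Y *m 'J S y).
Proof. by rewrite /dotm /induced_metric trmx_mul !mulmxA. Qed.

Lemma posdef_induced y : U y -> posdef (g y).
Proof.
move=> Uy; have [hT h0] := ph (UW Uy); split.
  by rewrite /induced_metric !trmx_mul trmxK hT mulmxA.
move=> X X0; rewrite dotm_induced; apply: h0.
apply: contra_neq X0 => XJ.
by apply/(row_free_inj (rS Uy)); rewrite XJ mul0mx.
Qed.

Lemma dirE y X : U y -> 'D_X S y = X *m 'J S y.
Proof. by move=> Uy; exact: (deriveEjacobian X (smooth_differentiable sS Uy)). Qed.

Lemma smooth_jacobian : smooth_on U (fun y => 'J S y).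
Proof.
apply: (smooth_mx oU) => i j.
apply: (smooth_eq oU (f := fun y => 'D_(delta_mx 0 i) S y 0 j)).
  by move=> y Uy; rewrite (dirE _ Uy) -rowE mxE.
by apply: (smooth_entry oU); exact: smooth_derive.
Qed.

Lemma smooth_induced : smooth_on U g.
Proof.
apply: (smooth_mulmx oU); last by apply: (smooth_trmx oU); exact: smooth_jacobian.
apply: (smooth_mulmx oU); first exact: smooth_jacobian.
exact: (smooth_comp oU UW).
Qed.

Lemma dotm_tangential y V Z : U y ->
  dotm (g y) (tangential_part S y V) Z = V ⋅[y] (Z *m 'J S y).
Proof.
move=> Uy; rewrite /dotm /tangential_part mulmxKV ?posdef_unitmx //.
  by rewrite trmx_mul !mulmxA.
exact: posdef_induced.
Qed.

Local Opaque nabla_along christoffel_form dotm.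

Lemma normal_part_orth y V Z : U y -> (normal_part S y V) ⋅[y] (Z *m 'J S y) = 0.
Proof.
move=> Uy; rewrite /normal_part dotmDl dotmNl -dotm_induced dotm_tangential //.
by rewrite subrr.
Qed.

Lemma dotm_split y u1 u2 v1 v2 : U y ->
  (forall Z, v1 ⋅[y] (Z *m 'J S y) = 0) -> (forall Z, v2 ⋅[y] (Z *m 'J S y) = 0) ->
  (u1 *m 'J S y + v1) ⋅[y] (u2 *m 'J S y + v2) = dotm (g y) u1 u2 + v1 ⋅[y] v2.
Proof.
move=> Uy o1 o2; rewrite dotmDl !dotmDr o1 add0r dotm_induced.
by rewrite (dotmC (u1 *m _) v2 (ph (UW Uy)).1) o2 addr0.
Qed.

Lemma tangential_normal y V : V = tangential_part S y V *m 'J S y + normal_part S y V.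
Proof. by rewrite /normal_part addrC subrK. Qed.

Let dS X y : U y -> differentiable ('D_X S) y.
Proof. by move=> Uy; exact: (smooth_differentiable (smooth_derive X sS) Uy). Qed.

Lemma derive_induced y X Y Z : U y ->
  'D_X (fun y => dotm (g y) Y Z) y =
  (nab X ('D_Y S) y) ⋅[y] (Z *m 'J S y) + (nab X ('D_Z S) y) ⋅[y] (Y *m 'J S y).
Proof.
move=> Uy; have hT := (ph (UW Uy)).1.
have ne : \near y, dotm (g y) Y Z = ('D_Y S y) ⋅[y] ('D_Z S y).
  by apply: (near_open oU Uy) => z Uz; rewrite dotm_induced !dirE.
rewrite (near_eq_derive X ne).
have [_ e] := diff_metric_along oW UW sS sh ph Uy (dS Y Uy) (dS Z Uy).
by rewrite (e X) !dirE // (dotmC (Y *m 'J S y) _ hT).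
Qed.

(** Both sides are paired with [Z]. Koszul's formula for the induced metric, expanded by ambient
    metric compatibility, has six terms; vanishing torsion identifies them in pairs, and only one
    pair survives. *)
Lemma tangential_nabla y X Y : U y -> tangential_part S y (nab X ('D_Y S) y) = Gg y X Y.
Proof.
move=> Uy; apply: (posdef_inj (posdef_induced Uy)) => Z.
rewrite (dotm_tangential _ _ Uy).
rewrite (koszul smooth_induced (fun y Uy => posdef_induced Uy) X Y Z Uy).
rewrite (derive_induced X Y Z Uy) (derive_induced Y X Z Uy) (derive_induced Z X Y Uy).
have sym A B := nabla_along_sym oU oW UW sS sh ph A B Uy.
rewrite [nab Y ('D_X S) y]sym [nab Z ('D_X S) y]sym [nab Z ('D_Y S) y]sym.
have aux (a b c : R) : a = 2^-1 * (a + b + (a + c) - (b + c)) by field.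
exact: aux.
Qed.

(** Gauss's formula. Writing the field [Y *m 'J S y] as ['D_Y S] makes the commutation of
    derivatives applicable. *)
Lemma second_ffE y X Y : U y ->
  second_ff S y X Y = nab X ('D_Y S) y - Gg y X Y *m 'J S y.
Proof.
move=> Uy; rewrite /second_ff /normal_part.
rewrite (nabla_along_eq oU X Uy (V' := 'D_Y S)); last by move=> z Uz; rewrite dirE.
by rewrite tangential_nabla.
Qed.

Lemma second_ff_orth y X Y Z : U y -> (second_ff S y X Y) ⋅[y] (Z *m 'J S y) = 0.
Proof. exact: normal_part_orth. Qed.

Let sg := smooth_induced.
Let pg : forall y, U y -> posdef (g y) := fun y Uy => posdef_induced Uy.

Lemma second_ff_sym y X Y : U y -> second_ff S y X Y = second_ff S y Y X.
Proof.
move=> Uy; rewrite !second_ffE // (christoffel_form_sym oU sg pg X Y Uy).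
by rewrite (nabla_along_sym oU oW UW sS sh ph X Y Uy).
Qed.

Lemma second_ff_linr y X Y Y' c : U y ->
  second_ff S y X (c *: Y + Y') = c *: second_ff S y X Y + second_ff S y X Y'.
Proof.
move=> Uy; rewrite !second_ffE // christoffel_form_linr.
have e z : U z -> 'D_(c *: Y + Y') S z = c *: 'D_Y S z + 'D_Y' S z.
  by move=> Uz; exact: (derive_dir_lin c Y Y' (smooth_differentiable sS Uz)).
rewrite (@nabla_along_eq _ _ _ U h S oU X ('D_(c *: Y + Y') S) _ y Uy e).
rewrite (nabla_along_lin sS X c Uy (dS Y Uy) (dS Y' Uy)).
rewrite mulmxDl -scalemxAl.
have aux (k : R) (a a' b b' : 'rV[R]_m) :
    k *: a + a' - (k *: b + b') = k *: (a - b) + (a' - b').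
  by rewrite scalerBr opprD addrACA.
exact: aux.
Qed.

Lemma differentiable_second_ff x X Y : U x -> differentiable (fun y => second_ff S y X Y) x.
Proof.
move=> Ux.
apply: (@near_eq_differentiable _ _ _ (fun y => nab X ('D_Y S) y - Gg y X Y *m 'J S y)).
  by apply: (near_open oU Ux) => y Uy; rewrite second_ffE.
apply: differentiableB.
  exact: (differentiable_nabla_along oU oW UW sS sh ph X Ux (smooth_derive Y sS)).
apply: (smooth_differentiable (U := U)) => //.
apply: (smooth_mulmx oU); last exact: smooth_jacobian.
exact: (smooth_christoffel_form oU sg pg X Y).
Qed.

(* The derivative of [<sigma (B, C), T> = 0] in the direction [A]. *)
Lemma nabla_second_ff x A B C T : U x ->
  (nab A (fun y => second_ff S y B C) x) ⋅[x] (T *m 'J S x) =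
  - ((second_ff S x B C) ⋅[x] (second_ff S x A T)).
Proof.
move=> Ux; have dN := differentiable_second_ff B C Ux.
have [_ e] := diff_metric_along oW UW sS sh ph Ux dN (dS T Ux).
have n0 : \near x, (second_ff S x B C) ⋅[x] ('D_T S x) = 0.
  by apply: (near_open oU Ux) => y Uy; rewrite dirE // second_ff_orth.
have := e A; rewrite (near_eq_derive A n0) derive_cst (dirE T Ux) => e'.
have -> : second_ff S x A T = nab A ('D_T S) x - Gg x A T *m 'J S x by exact: second_ffE.
rewrite (dotmDr _ (second_ff S x B C) (nab A ('D_T S) x)) dotmNr second_ff_orth // subr0.
by apply/eqP; rewrite -addr_eq0 -e'.
Qed.

(** Leibniz rule for a tangent field with variable components; the last term differentiates the
    field with components frozen at [u x]. *)
Lemma nabla_tangent x A (u : 'rV[R]_n -> 'rV[R]_n) : U x -> differentiable u x ->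
  nab A (fun y => u y *m 'J S y) x =
  'D_A u x *m 'J S x + nab A ('D_(u x) S) x.
Proof.
move=> Ux du.
pose L y (s : 'rV[R]_n) := s *m 'J S y.
have [||_ d2] := @diff_lin_family _ _ _ _ L u x _ _ du.
- by move=> z s s' c; rewrite /L mulmxDl scalemxAl.
- move=> s; apply: (smooth_differentiable (U := U)) => //.
  by apply: (smooth_mulmx oU); [exact: smooth_cst|exact: smooth_jacobian].
rewrite (nabla_alongE sS A _ Ux) (nabla_alongE sS A ('D_(u x) S) Ux) d2 /L.
rewrite (dirE (u x) Ux).
have -> : 'D_A ('D_(u x) S) x = 'D_A (fun y => u x *m 'J S y) x.
  by apply: near_eq_derive; apply: (near_open oU Ux) => y Uy; rewrite dirE.
by rewrite addrAC addrC addrA.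
Qed.

(** The first derivative of ['D_Z S] is split into tangential and normal parts before the second one
    is taken; differentiating the normal part produces, through [nabla_second_ff], the quadratic
    terms. *)
Lemma gauss x X Y Z T : U x ->
  dotm (g x) (curvature g x X Y Z) T =
  (curvature h (S x) (X *m 'J S x) (Y *m 'J S x) (Z *m 'J S x)) ⋅[x] (T *m 'J S x)
  + (second_ff S x Y Z) ⋅[x] (second_ff S x X T)
  - (second_ff S x X Z) ⋅[x] (second_ff S x Y T).
Proof.
move=> Ux; have sG A B := smooth_christoffel_form oU sg pg A B.
have dG A B := smooth_differentiable (sG A B) Ux.
have tangent (u : 'rV[R]_n) A : (nab A ('D_u S) x) ⋅[x] (T *m 'J S x) = dotm (g x) (Gg x A u) T.
  by rewrite -(tangential_nabla A u Ux) dotm_tangential.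
have E A B : (nab A (nab B ('D_Z S)) x) ⋅[x] (T *m 'J S x) =
  dotm (g x) ('D_A (fun y => Gg y B Z) x + Gg x A (Gg x B Z)) T
  - ((second_ff S x B Z) ⋅[x] (second_ff S x A T)).
  rewrite (nabla_along_eq oU A Ux (V' := fun y => 1 *: (Gg y B Z *m 'J S y) + second_ff S y B Z)); last first.
    by move=> y Uy; rewrite second_ffE // scale1r addrC subrK.
  have dT : differentiable (fun y => Gg y B Z *m 'J S y) x.
    apply: (smooth_differentiable (U := U)) => //.
    by apply: (smooth_mulmx oU); [exact: sG|exact: smooth_jacobian].
  rewrite (nabla_along_lin sS A 1 Ux dT (differentiable_second_ff B Z Ux)) scale1r.
  rewrite (nabla_tangent A Ux (dG B Z)).
  rewrite (dotmDl _ (_ *m 'J S x + nab A ('D_(Gg x B Z) S) x)).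
  rewrite (nabla_second_ff A B Z T Ux).
  rewrite (dotmDl _ ('D_A (fun y => Gg y B Z) x *m 'J S x)) -dotm_induced tangent.
  by rewrite (dotmDl (g x) ('D_A (fun y => Gg y B Z) x)).
have c := nabla_along_curvature oU oW UW sS sh ph X Y Ux (smooth_derive Z sS).
rewrite (dirE X Ux) (dirE Y Ux) (dirE Z Ux) in c.
rewrite -c (dotmDl _ (nab X (nab Y ('D_Z S)) x)) dotmNl (E X Y) (E Y X) curvatureE.
rewrite (dotmDl (g x) _ (- _)) dotmNl.
have aux (a b p q : R) : a - b = a - p - (b - q) + p - q by ring.
exact: aux.
Qed.

(** * Tangential and normal parts of the complex structure *)

Section Slant.
Hypothesis sJ : smooth_on W J.
Hypothesis pJ : forall z, W z -> parallel_at h (fun y Y => Y *m J y) z.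
Hypothesis JJ : forall z, W z -> J z *m J z = - 1%:M.
Hypothesis hJ : forall z, W z -> forall X Y, dotm (h z) (X *m J z) (Y *m J z) = dotm (h z) X Y.

Lemma dotmJ_skew z X Y : W z -> dotm (h z) (X *m J z) Y = - dotm (h z) X (Y *m J z).
Proof.
move=> Wz; rewrite -(hJ Wz X) -mulmxA (JJ Wz) mulmxN mulmx1 dotmNr.
by rewrite opprK.
Qed.

Lemma JX_split y X : JX S y X = PX S y X *m 'J S y + FX S y X.
Proof. exact: tangential_normal. Qed.

Lemma dotm_PX y X Z : U y -> dotm (g y) (PX S y X) Z = (JX S y X) ⋅[y] (Z *m 'J S y).
Proof. by move=> Uy; rewrite /PX dotm_tangential. Qed.

Lemma FX_orth y X Z : U y -> (FX S y X) ⋅[y] (Z *m 'J S y) = 0.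
Proof. exact: normal_part_orth. Qed.

Lemma PX_skew y X Z : U y -> dotm (g y) (PX S y X) Z = - dotm (g y) X (PX S y Z).
Proof.
move=> Uy; have pgy := (pg Uy).1; rewrite (dotmC X _ pgy) !dotm_PX //.
by rewrite (dotmJ_skew _ _ (UW Uy)) dotmC //; exact: (ph (UW Uy)).1.
Qed.

Lemma smooth_PX X : smooth_on U (fun y => PX S y X).
Proof.
apply: (smooth_mulmx oU); last first.
  apply: (smooth_invmx oU); last exact: smooth_induced.
  by move=> y Uy; apply: posdef_unitmx; exact: posdef_induced.
apply: (smooth_mulmx oU); last by apply: (smooth_trmx oU); exact: smooth_jacobian.
apply: (smooth_mulmx oU); last exact: (smooth_comp oU UW).
apply: (smooth_mulmx oU); last exact: (smooth_comp oU UW).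
by apply: (smooth_mulmx oU); [exact: smooth_cst|exact: smooth_jacobian].
Qed.

(* Obtained by differentiating [<J X, Z> = g (P X, Z)] in the direction [Y]. *)
Lemma second_ff_cubic x X Y Z : U x -> parallel_at g (PX S) x ->
  (second_ff S x Y X) ⋅[x] (FX S x Z) = (second_ff S x Y Z) ⋅[x] (FX S x X).
Proof.
move=> Ux par; have hT := (ph (UW Ux)).1.
have [dJX nJX] := nabla_along_J oW sJ pJ Y oU UW sS Ux (dS X Ux).
have [_ e1] := diff_metric_along oW UW sS sh ph Ux dJX (dS Z Ux).
have dP := smooth_differentiable (smooth_PX X) Ux.
have dZ : differentiable (cst Z) x := differentiable_cst _ _.
have UU : forall y, U y -> U (id y) by [].
have sid := smooth_id oU.
have [_ e2] := diff_metric_along oU UU sid sg pg Ux dP dZ.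
have ne : \near x, ('D_X S x *m J (S x)) ⋅[x] ('D_Z S x) = dotm (g x) (PX S x X) Z.
  by apply: (near_open oU Ux) => y Uy; rewrite dotm_PX // !dirE.
have := e1 Y; rewrite (near_eq_derive Y ne) (e2 Y) nJX.
(* Parallelism of [P] enters here: the derivative of [P X] is [P] of the derivative of [X]. *)
have -> : nabla_along g id Y (fun y => PX S y X) x = PX S x (Gg x Y X).
  have := par Y X; rewrite /nabla derive_cst add0r => <-.
  by rewrite (nabla_alongE sid Y _ Ux) derive_id.
rewrite (@nabla_id_cst R n U g oU Y Z x Ux).
have spl A B : nab A ('D_B S) x = Gg x A B *m 'J S x + second_ff S x A B.
  by rewrite second_ffE // addrC subrK.
have eJ A : 'D_A S x *m J (S x) = PX S x A *m 'J S x + FX S x A.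
  by rewrite -JX_split (dirE A Ux).
(* After splitting into tangential and normal parts, the tangential terms agree on both sides
   because [P] is skew; only pairings of [second_ff] with [FX] survive. *)
rewrite (dotmJ_skew _ _ (UW Ux)) (eJ X) (eJ Z) (spl Y X) (spl Y Z).
have oF A B := FX_orth A B Ux; have os A B C := second_ff_orth A B C Ux.
rewrite (dotm_split _ _ Ux (os Y X) (oF Z)) (dotm_split _ _ Ux (oF X) (os Y Z)).
rewrite (PX_skew (Gg x Y X) Z Ux) (dotmC (FX S x X) _ hT).
have aux (a b p q : R) : - a + b = - (a + p) + (b + q) -> p = q by lra.
exact: aux.
Qed.

End Slant.
End Immersion.

(** * Pointwise algebra *)

Section Cubic.
Context {R : realFieldType} {n : nat}.
Variable a : 'I_n -> 'I_n -> 'I_n -> R.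
Hypothesis a12 : forall i j k, a i j k = a j i k.
Hypothesis a23 : forall i j k, a i j k = a i k j.
Hypothesis n2 : (1 < n)%N.

Let T l := \sum_j a j j l.
Let N : R := n%:R.
Let s i := \sum_(j | j != i) a i j j.

Let N_ge2 : 2 <= N. Proof. by rewrite /N (ler_nat R 2 n). Qed.

(* For [j != i] the square [a_iij ^ 2] occurs both as the [j]-part of
   [a_ii. ^ 2] and as the [i]-part of [a_ij. ^ 2]; completing squares separately
   in the families [(a_ijj)_j] and [(a_iil, T_l)], [l != i], gives the right-hand
   side. *)
Lemma cubic_deficit i :
  (N - 1) / (4 * N) * \sum_l T l ^+ 2 -
    \sum_(j | j != i) (\sum_l a i i l * a j j l - \sum_l a i j l ^+ 2) =
  (N - 1) / (4 * N) * (a i i i - (N + 1) / (N - 1) * s i) ^+ 2 +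
  \sum_(j | j != i) (a i j j - s i / (N - 1)) ^+ 2 +
  \sum_(l | l != i) ((N - 2) / (8 * N) * T l ^+ 2 + 2 * (a i i l - T l / 4) ^+ 2) +
  \sum_(j | j != i) \sum_(l | (l != i) && (l != j)) a i j l ^+ 2.
Proof.
set rest := \sum_(j | j != i) \sum_(l | _) _.
have N0 : N != 0 by rewrite gt_eqF //; have := N_ge2; lra.
have N10 : N - 1 != 0 by rewrite gt_eqF //; have := N_ge2; lra.
have Ti : T i = a i i i + s i.
  rewrite /T (bigD1 i) //=; congr (_ + _); apply: eq_bigr => j _.
  by rewrite a23 a12.
have Tl l : \sum_(j | j != i) a j j l = T l - a i i l.
  by rewrite /T [in RHS](bigD1 i) //= addrC addrK.
set q := \sum_(j | j != i) a i j j ^+ 2.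
(* The deviations from the mean [s i / (N - 1)] leave [s i ^+ 2 / (N - 1)], exactly the term that
   makes the remaining form in [a i i i] and [s i] a perfect square. *)
have var : \sum_(j | j != i) (a i j j - s i / (N - 1)) ^+ 2 = q - s i ^+ 2 / (N - 1).
  rewrite (eq_bigr (fun j => a i j j ^+ 2 + (- 2 * (s i / (N - 1)) * a i j j +
    (s i / (N - 1)) ^+ 2))); last by move=> j _; ring.
  rewrite big_split big_split /= -/q -mulr_sumr -/(s i) sumr_const.
  have -> : #|[pred j | j != i]| = n.-1 by rewrite -[n in RHS]card_ord (cardC1 i).
  rewrite -[_ *+ n.-1]mulr_natr.
  have -> : (n.-1)%:R = N - 1 by rewrite -subn1 natrB // ltnW.
  by field.
have S1 : \sum_(j | j != i) \sum_l a i i l * a j j l =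
    a i i i * s i + \sum_(l | l != i) a i i l * (T l - a i i l).
  rewrite exchange_big (bigD1 i) //=; congr (_ + _).
    by rewrite -mulr_sumr Tl Ti addrC addKr.
  by apply: eq_bigr => l _; rewrite -mulr_sumr Tl.
have S2 : \sum_(j | j != i) \sum_l a i j l ^+ 2 =
    \sum_(l | l != i) a i i l ^+ 2 + q + rest.
  rewrite /q /rest -!big_split; apply: eq_bigr => j ji /=.
  rewrite (bigD1 i) //= (bigD1 j) //= addrA; congr (_ + _ + _).
  by rewrite a23.
rewrite sumrB S1 S2 var (bigD1 i) //= Ti.
(* For each [l] the form is [(N - 1) / (4 * N) * T l ^+ 2 - a i i l * T l + 2 * a i i l ^+ 2];
   completing the square in [a i i l] leaves the coefficient [(N - 1) / (4 * N) - 1 / 8 = (N - 2) /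
   (8 * N)]. *)
have S3 : \sum_(l | l != i) ((N - 2) / (8 * N) * T l ^+ 2 + 2 * (a i i l - T l / 4) ^+ 2) =
  (N - 1) / (4 * N) * \sum_(l | l != i) T l ^+ 2 -
  \sum_(l | l != i) a i i l * (T l - a i i l) + \sum_(l | l != i) a i i l ^+ 2.
  rewrite mulr_sumr -sumrB -big_split; apply: eq_bigr => l _ /=.
  by field.
rewrite S3; set X1 := \sum_(l | l != i) T l ^+ 2; set X2 := \sum_(l | _) _.
set X3 := \sum_(l | _) _.
move: X1 X2 X3 rest q (s i) (a i i i) {S1 S2 S3 var Ti} => X1 X2 X3 rest q si x.
by field; rewrite N0 N10.
Qed.

Let coef_gt0 : 0 < (N - 1) / (4 * N).
Proof. by rewrite divr_gt0 //; have := N_ge2; lra. Qed.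

Let coef_ge0 : 0 <= (N - 2) / (8 * N).
Proof. by rewrite divr_ge0 //; have := N_ge2; lra. Qed.

Let term_ge0 l i : 0 <= (N - 2) / (8 * N) * T l ^+ 2 + 2 * (a i i l - T l / 4) ^+ 2.
Proof.
have h1 := mulr_ge0 coef_ge0 (sqr_ge0 (T l)); have h2 := sqr_ge0 (a i i l - T l / 4); lra.
Qed.

Lemma cubic_le i :
  \sum_(j | j != i) (\sum_l a i i l * a j j l - \sum_l a i j l ^+ 2) <=
  (N - 1) / (4 * N) * \sum_l T l ^+ 2.
Proof.
rewrite -subr_ge0 cubic_deficit !addr_ge0 //.
- by rewrite mulr_ge0 ?sqr_ge0 // ltW.
- by apply: sumr_ge0 => j _; exact: sqr_ge0.
- by apply: sumr_ge0 => l _.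
- by apply: sumr_ge0 => j _; apply: sumr_ge0 => l _; exact: sqr_ge0.
Qed.

(** All terms of the sum of squares vanish. The families extracted are those in [T l] and in
    distinct indices: for [n > 2] the former forces the trace to vanish, and for [n = 2] it ties
    [a i i l] to the trace. *)
Lemma cubic_eq i :
  \sum_(j | j != i) (\sum_l a i i l * a j j l - \sum_l a i j l ^+ 2) =
    (N - 1) / (4 * N) * \sum_l T l ^+ 2 ->
  (forall l, l != i -> (N - 2) * T l = 0 /\ 4 * a i i l = T l) /\
  (forall j l, j != i -> l != i -> l != j -> a i j l = 0).
Proof.
move=> e; have := cubic_deficit i; rewrite e subrr => H.
have u0 : 0 <= (N - 1) / (4 * N) * (a i i i - (N + 1) / (N - 1) * s i) ^+ 2.
  by rewrite mulr_ge0 ?sqr_ge0 // ltW.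
have v0 : 0 <= \sum_(j | j != i) (a i j j - s i / (N - 1)) ^+ 2.
  by apply: sumr_ge0 => j _; exact: sqr_ge0.
have w0 := sumr_ge0 (index_enum 'I_n) (fun l (_ : l != i) => term_ge0 l i).
have r0 : 0 <= \sum_(j | j != i) \sum_(l | (l != i) && (l != j)) a i j l ^+ 2.
  by apply: sumr_ge0 => j _; apply: sumr_ge0 => l _; exact: sqr_ge0.
have aux (u v w r : R) : 0 <= u -> 0 <= v -> 0 <= w -> 0 <= r ->
  0 = u + v + w + r -> w = 0 /\ r = 0 by move=> *; split; lra.
have [w00 r00] := aux _ _ _ _ u0 v0 w0 r0 H.
split.
  move=> l li; have /eqP := w00; rewrite psumr_eq0; last by move=> *; exact: term_ge0.
  move=> /allP/(_ l (mem_index_enum l))/implyP/(_ li).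
  rewrite paddr_eq0; [|exact: (mulr_ge0 coef_ge0 (sqr_ge0 _))|by rewrite mulr_ge0 ?sqr_ge0].
  move=> /andP[/eqP h1 /eqP h2]; have N0 : N != 0 by rewrite gt_eqF //; have := N_ge2; lra.
  split.
    apply/eqP; rewrite -sqrf_eq0.
    (* Keeping the factor [N - 2] avoids a case distinction: the identity also holds when it is
       zero. *)
    have -> : ((N - 2) * T l) ^+ 2 = (N - 2) * (8 * N) * ((N - 2) / (8 * N) * T l ^+ 2).
      by field; rewrite N0.
    by rewrite h1 mulr0.
  have : (a i i l - T l / 4) ^+ 2 = 0 by lra.
  by move/eqP; rewrite sqrf_eq0 => /eqP; lra.
move=> j l ji li lj; have /eqP := r00.
rewrite psumr_eq0; last by move=> *; apply: sumr_ge0 => *; exact: sqr_ge0.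
move=> /allP/(_ j (mem_index_enum j))/implyP/(_ ji).
rewrite psumr_eq0; last by move=> *; exact: sqr_ge0.
move=> /allP/(_ l (mem_index_enum l))/implyP; rewrite li lj => /(_ isT).
by rewrite expf_eq0 /= => /eqP.
Qed.

(** A vanishing trace kills every [a i i l] with [l != i], then [a i i i]; three distinct indices
    are covered by [cubic_eq]. *)
Lemma cubic_eq0 :
  (forall i, \sum_(j | j != i) (\sum_l a i i l * a j j l - \sum_l a i j l ^+ 2) =
    (N - 1) / (4 * N) * \sum_l T l ^+ 2) ->
  (forall l, T l = 0) -> forall i j k, a i j k = 0.
Proof.
move=> H T0.
have H1 i l : l != i -> a i i l = 0.
  by move=> li; have [/(_ l li)[_]] := cubic_eq (H i); rewrite T0 => ? _; lra.
have H2 i : a i i i = 0.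
  have := T0 i; rewrite /T (bigD1 i) //= big1 ?addr0 // => j ji.
  by apply: H1; rewrite eq_sym.
move=> i j k; have [<-|ij] := eqVneq i j.
  by have [->|ki] := eqVneq k i; [exact: H2|exact: H1].
have [<-|ik] := eqVneq i k; first by rewrite a23 H1 // eq_sym.
have [<-|jk] := eqVneq j k; first by rewrite a12 a23 H1 // .
by apply: (cubic_eq (H i)).2; rewrite // eq_sym.
Qed.

End Cubic.

(** * Orthonormal frames *)

Lemma dotm_normalize (R : realType) n (A : 'M[R]_n) (v : 'rV[R]_n) :
  posdef A -> v != 0 ->
  dotm A ((Num.sqrt (dotm A v v))^-1 *: v) ((Num.sqrt (dotm A v v))^-1 *: v) = 1.
Proof.
move=> pA v0; have vv := pA.2 v v0.
rewrite dotmZl dotmZr mulrA -invfM -expr2 sqr_sqrtr ?(ltW vv) // mulVf //.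
by rewrite gt_eqF.
Qed.

Lemma posdef_unit_vector (R : realType) n (A : 'M[R]_n) :
  posdef A -> (0 < n)%N -> exists X, dotm A X X = 1.
Proof.
move=> pA n0; pose X : 'rV[R]_n := delta_mx 0 (Ordinal n0).
have X0 : X != 0.
  by apply/eqP => /rowP/(_ (Ordinal n0)); rewrite !mxE !eqxx => /eqP; rewrite oner_eq0.
by eexists; exact: (dotm_normalize pA X0).
Qed.

(** The frame grows one vector at a time: orthogonality to [k < n] vectors is a homogeneous system
    of [k] equations in [n] unknowns, whose nonzero solution is normalised. Partial frames are
    indexed by [nat], with only the first [k] values meaningful. *)
Lemma orthonormal_extend (R : realType) n (A : 'M[R]_n) (X : 'rV[R]_n) :
  posdef A -> dotm A X X = 1 -> exists e i, orthonormal_basis A e /\ e i = X.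
Proof.
move=> pA X1.
have n0 : (0 < n)%N.
  case: n A X pA X1 => // A X _; rewrite dotm_sum big_ord0 => /esym/eqP.
  by rewrite oner_eq0.
suff H : forall k, (0 < k <= n)%N -> exists2 e : nat -> 'rV[R]_n, e 0%N = X &
    forall i j, (i < k)%N -> (j < k)%N -> dotm A (e i) (e j) = (i == j)%:R.
  have [|e e0 eo] := H n; first by rewrite n0 leqnn.
  by exists (fun i : 'I_n => e i), (Ordinal n0); split=> // i j; exact: eo.
elim=> [//|k IH] /andP[_ kn].
have [->|k0] := posnP k.
  exists (fun _ => X) => // i j; rewrite !ltnS !leqn0 => /eqP -> /eqP ->.
  by rewrite X1.
have [|e e0 eo] := IH; first by rewrite k0 ltnW.
pose E : 'M[R]_(k, n) := \matrix_(i < k) e i.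
have : kermx (A *m E^T) != 0.
  rewrite kermx_eq0 /row_free; apply: contraTneq kn => rk.
  by rewrite -ltnNge ltnS -rk; exact: rank_leq_col.
move=> /rowV0Pn[v /sub_kermxP vE v0].
have vo (i : nat) : (i < k)%N -> dotm A v (e i) = 0.
  move=> ik; have := congr1 (fun M : 'rV[R]_k => M 0 (Ordinal ik)) vE.
  rewrite mulmxA !mxE /dotm => <-; rewrite !mxE; apply: eq_bigr => j _.
  by rewrite !mxE.
pose w := (Num.sqrt (dotm A v v))^-1 *: v.
have wo (i : nat) : (i < k)%N -> dotm A w (e i) = 0.
  by move=> ik; rewrite dotmZl vo // mulr0.
have ww : dotm A w w = 1 := dotm_normalize pA v0.
exists (fun i => if i == k then w else e i).
  by rewrite eq_sym gtn_eqF.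
move=> i j; rewrite !ltnS; case: (eqVneq i k) => [->|ik]; case: (eqVneq j k) => [->|jk] hi hj.
- by rewrite ww.
- by rewrite wo ?ltn_neqAle ?jk // eq_sym (negPf jk).
- by rewrite (dotmC _ _ pA.1) wo ?ltn_neqAle ?ik // (negPf ik).
- by apply: eo; rewrite ltn_neqAle ?ik ?jk.
Qed.

Section Orthonormal.
Context {R : realType} {n : nat} {A : 'M[R]_n} {e : 'I_n -> 'rV[R]_n}.
Hypothesis pA : posdef A.
Hypothesis oe : orthonormal_basis A e.

(** Orthonormality says [E A E^T = 1] for the square frame matrix [E]; one-sided inverses being
    two-sided, [A E^T E = 1]. *)
Lemma orthonormal_invmx : invmx A = (\matrix_i e i)^T *m (\matrix_i e i).
Proof.
set E := \matrix_i e i.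
have EAE : E *m (A *m E^T) = 1%:M.
  apply/matrixP => i j; rewrite mulmxA [RHS]mxE -oe /dotm !mxE.
  apply: eq_bigr => k _; rewrite !mxE; congr (_ * _).
  by apply: eq_bigr => l _; rewrite !mxE.
have AEE : A *m (E^T *m E) = 1%:M by rewrite mulmxA; exact: mulmx1C.
by rewrite -[LHS]mulmx1 -AEE mulKmx //; exact: posdef_unitmx.
Qed.

Lemma orthonormal_expand V : V = \sum_j dotm A V (e j) *: e j.
Proof.
have Au := posdef_unitmx pA.
rewrite -[LHS](mulmxK Au) orthonormal_invmx mulmxA.
rewrite [LHS]mulmx_sum_row; apply: eq_bigr => j _; rewrite rowK; congr (_ *: _).
by rewrite /dotm !mxE; apply: eq_bigr => k _; rewrite !mxE.
Qed.

Lemma parseval V V' : dotm A V V' = \sum_j dotm A V (e j) * dotm A V' (e j).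
Proof.
rewrite {1}(orthonormal_expand V') dotm_sumr; apply: eq_bigr => j _.
by rewrite dotmZr mulrC.
Qed.

(** The left-hand side does not mention the frame, so this both evaluates metric traces and shows
    that frame sums do not depend on the frame. *)
Lemma trace_orthonormal (W : lmodType R) (q : 'rV[R]_n -> 'rV[R]_n -> W) :
  (forall X X' Y c, q (c *: X + X') Y = c *: q X Y + q X' Y) ->
  (forall X Y Y' c, q X (c *: Y + Y') = c *: q X Y + q X Y') ->
  \sum_i \sum_j invmx A i j *: q (delta_mx 0 i) (delta_mx 0 j) = \sum_k q (e k) (e k).
Proof.
move=> ql qr.
have q0l Y : q 0 Y = 0 by have := ql 0 0 Y (-1); rewrite scaler0 addr0 scaleN1r addNr.
have q0r X : q X 0 = 0 by have := qr X 0 0 (-1); rewrite scaler0 addr0 scaleN1r addNr.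
have qs (X Y : 'rV_n) : q X Y = \sum_i \sum_j (X 0 i * Y 0 j) *: q (delta_mx 0 i) (delta_mx 0 j).
  rewrite {1}(row_sum_delta X); transitivity (\sum_i X 0 i *: q (delta_mx 0 i) Y).
    by elim/big_rec2: _ => [//|i p u _ IH]; rewrite ql IH.
  apply: eq_bigr => i _; rewrite {1}(row_sum_delta Y).
  transitivity (X 0 i *: \sum_j Y 0 j *: q (delta_mx 0 i) (delta_mx 0 j)).
    by congr (_ *: _); elim/big_rec2: _ => [//|j p u _ IH]; rewrite qr IH.
  by rewrite scaler_sumr; apply: eq_bigr => j _; rewrite scalerA.
rewrite [RHS](eq_bigr (fun k => \sum_i \sum_j (e k 0 i * e k 0 j) *: q (delta_mx 0 i) (delta_mx 0 j)));
  last by move=> k _; rewrite (qs (e k) (e k)).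
rewrite [RHS]exchange_big; apply: eq_bigr => i _.
rewrite [RHS]exchange_big; apply: eq_bigr => j _.
rewrite -scaler_suml orthonormal_invmx mxE; congr (_ *: _).
by apply: eq_bigr => k _; rewrite !mxE.
Qed.

End Orthonormal.

Lemma ord2_other n (i : 'I_n) : n = 2%N -> exists2 j, j != i & forall k, k = i \/ k = j.
Proof.
move=> n2; have [j ji] : exists j, j != i.
  have : (0 < #|[pred j | j != i]|)%N by rewrite (cardC1 i) card_ord n2.
  by move=> /card_gt0P[j]; rewrite inE; exists j.
exists j => // k; suff : (k == i) || (k == j) by case/orP=> /eqP; [left|right].
move: ji (ltn_ord i) (ltn_ord j) (ltn_ord k); rewrite -!val_eqE.
rewrite [X in (i < X)%N]n2 [X in (j < X)%N]n2 [X in (k < X)%N]n2 /=.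
by case: (nat_of_ord i) (nat_of_ord j) (nat_of_ord k) => [|[|?]] [|[|?]] [|[|?]].
Qed.

(** * The extrinsic part of the Ricci curvature at one point *)

Section Pointwise.
Context {R : realType} {n : nat} {A : 'M[R]_n} {B : 'M[R]_(2 * n)}.
Context {J0 : 'M[R]_(n, 2 * n)} {F : 'rV[R]_n -> 'rV[R]_(2 * n)}.
Context {sig : 'rV[R]_n -> 'rV[R]_n -> 'rV[R]_(2 * n)} {s : R}.
Hypothesis pA : posdef A.
Hypothesis pB : posdef B.
Hypothesis rJ : row_free J0.
Hypothesis s0 : 0 < s.
Hypothesis FF : forall X Y, dotm B (F X) (F Y) = s ^+ 2 * dotm A X Y.
Hypothesis FL : forall X Y c, F (c *: X + Y) = c *: F X + F Y.
Hypothesis FJ : forall X Z, dotm B (F X) (Z *m J0) = 0.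
Hypothesis sigJ : forall X Y Z, dotm B (sig X Y) (Z *m J0) = 0.
Hypothesis sigC : forall X Y, sig X Y = sig Y X.
Hypothesis sigL : forall X Y Y' c, sig X (c *: Y + Y') = c *: sig X Y + sig X Y'.
Hypothesis sigF : forall X Y Z, dotm B (sig Y X) (F Z) = dotm B (sig Y Z) (F X).
Local Notation onb := (orthonormal_basis A).

Let s_neq0 : s != 0. Proof. by rewrite gt_eqF. Qed.

Let bJ : B^T = B := pB.1.

(** The rows of [J0] and the vectors [F (e l)] are independent, since [F] is a similarity with
    values orthogonal to the tangent space. There are [2 * n] of them, the ambient dimension, so
    they span. *)
Lemma normal_zero (e : 'I_n -> 'rV[R]_n) v : onb e ->
  (forall Z, dotm B v (Z *m J0) = 0) -> (forall l, dotm B v (F (e l)) = 0) -> v = 0.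
Proof.
move=> oe vJ vF; pose Fm : 'M[R]_(n, 2 * n) := \matrix_l F (e l).
pose M : 'M[R]_(n + n, 2 * n) := col_mx J0 Fm.
have uF (u : 'rV[R]_n) : u *m Fm = \sum_l u 0 l *: F (e l).
  by rewrite mulmx_sum_row; apply: eq_bigr => l _; rewrite rowK.
have fM : row_free M.
  rewrite -kermx_eq0; apply/rowV0P => u /sub_kermxP.
  rewrite -[u]hsubmxK mul_row_col; set u1 := lsubmx u; set u2 := rsubmx u => uM.
  have u2l l : u2 0 l = 0.
    have := congr1 (fun w => dotm B w (F (e l))) uM.
    rewrite dotmDl dotm0l (dotmC (u1 *m _) _ bJ) FJ add0r uF dotm_suml (bigD1 l) //=.
    rewrite dotmZl FF oe eqxx mulr1 big1 ?addr0 => [/eqP|k kl].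
      by rewrite mulf_eq0 expf_eq0 /= (negPf s_neq0) orbF => /eqP.
    by rewrite dotmZl FF oe (negPf kl) !mulr0.
  have u20 : u2 = 0 by apply/rowP => l; rewrite u2l mxE.
  move: uM; rewrite u20 mul0mx addr0 => uJ.
  have -> : u1 = 0 by apply/(row_free_inj rJ); rewrite uJ mul0mx.
  by rewrite row_mx0.
have /row_fullP[D DM] : row_full M.
  by move: fM; rewrite /row_full /row_free => /eqP ->; rewrite mul2n addnn.
have Mv : M *m (B *m v^T) = 0.
  rewrite mul_col_mx; apply/eqP; rewrite col_mx_eq0; apply/andP; split; apply/eqP/colP => l.
    have := vJ (delta_mx 0 l); rewrite (dotmC v _ bJ) /dotm -mulmxA -rowE -row_mul mxE => ->.
    by rewrite mxE.
  have := vF l; rewrite (dotmC v _ bJ) /dotm -mulmxA.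
  have -> : F (e l) = row l Fm by rewrite rowK.
  by rewrite -row_mul mxE => ->; rewrite mxE.
apply: (posdef_eq0 pB).
by rewrite /dotm -mulmxA -[B *m _]mul1mx -DM -mulmxA Mv !mulmx0 mxE.
Qed.

(** The vectors [s^-1 *: F (e l)] form an orthonormal frame of the normal space. *)
Lemma normal_expand (e : 'I_n -> 'rV[R]_n) v : onb e ->
  (forall Z, dotm B v (Z *m J0) = 0) ->
  v = \sum_l (dotm B v (F (e l)) / s) *: (s^-1 *: F (e l)).
Proof.
move=> oe vJ; apply/subr0_eq/(normal_zero oe) => [Z|k].
  rewrite dotmDl dotmNl vJ dotm_suml big1 ?subr0 // => l _.
  by rewrite !dotmZl FJ !mulr0.
rewrite dotmDl dotmNl dotm_suml (bigD1 k) //= big1 ?addr0 => [|l lk].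
  by rewrite !dotmZl FF oe eqxx mulr1; field.
by rewrite !dotmZl FF oe (negPf lk) !mulr0.
Qed.

Lemma normal_dotm (e : 'I_n -> 'rV[R]_n) v w : onb e ->
  (forall Z, dotm B v (Z *m J0) = 0) -> (forall Z, dotm B w (Z *m J0) = 0) ->
  dotm B v w = \sum_l (dotm B v (F (e l)) / s) * (dotm B w (F (e l)) / s).
Proof.
move=> oe vJ wJ; rewrite {1}(normal_expand oe wJ) dotm_sumr.
apply: eq_bigr => l _; rewrite !dotmZr; ring.
Qed.

Local Notation q e i := (\sum_(j | j != i) (dotm B (sig (e i) (e i)) (sig (e j) (e j)) -
  dotm B (sig (e i) (e j)) (sig (e i) (e j)))).
Local Notation H e := (\sum_j sig (e j) (e j)).
(** The cubic form: the components of [sig] in the normal frame [s^-1 *: F (e k)]. *)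
Let a (e : 'I_n -> 'rV[R]_n) i j k := dotm B (sig (e i) (e j)) (F (e k)) / s.

Let HJ (e : 'I_n -> 'rV[R]_n) Z : dotm B (H e) (Z *m J0) = 0.
Proof. by rewrite dotm_suml big1. Qed.

Let a12 e i j k : a e i j k = a e j i k.
Proof. by rewrite /a sigC. Qed.

Let a23 e i j k : a e i j k = a e i k j.
Proof. by rewrite /a sigF. Qed.

Let qE (e : 'I_n -> 'rV[R]_n) i : onb e -> q e i =
  \sum_(j | j != i) (\sum_l a e i i l * a e j j l - \sum_l a e i j l ^+ 2).
Proof.
by move=> oe; apply: eq_bigr => j _; rewrite !(normal_dotm oe) //.
Qed.

Let TE (e : 'I_n -> 'rV[R]_n) l : dotm B (H e) (F (e l)) / s = \sum_j a e j j l.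
Proof. by rewrite dotm_suml big_distrl. Qed.

Let HE (e : 'I_n -> 'rV[R]_n) : onb e -> dotm B (H e) (H e) = \sum_l (\sum_j a e j j l) ^+ 2.
Proof.
by move=> oe; rewrite (normal_dotm oe) //; apply: eq_bigr => l _; rewrite !TE.
Qed.

Lemma extrinsic_ricci_le (e : 'I_n -> 'rV[R]_n) i : (1 < n)%N -> onb e ->
  q e i <= (n%:R - 1) / (4 * n%:R) * dotm B (H e) (H e).
Proof.
by move=> n1 oe; rewrite qE // HE //; exact: (cubic_le (a12 e) (a23 e) n1).
Qed.

Lemma trace_frame_indep (e e' : 'I_n -> 'rV[R]_n) : onb e -> onb e' -> H e = H e'.
Proof.
move=> oe oe'; rewrite -(trace_orthonormal pA oe) ?(trace_orthonormal pA oe') //;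
  by move=> X X' Y c; rewrite ![sig _ Y]sigC.
Qed.

Lemma sig_frame e X Y : onb e -> (forall i j, sig (e i) (e j) = 0) -> sig X Y = 0.
Proof.
move=> oe s00.
have sr Z i : sig (e i) Z = 0.
  rewrite (orthonormal_expand pA oe Z).
  have z0 : sig (e i) 0 = 0.
    by have := sigL (e i) 0 0 (-1); rewrite scaler0 addr0 scaleN1r addNr.
  by elim/big_rec: _ => [//|j u _ IH]; rewrite sigL s00 scaler0 IH addr0.
rewrite (orthonormal_expand pA oe Y).
have z0 : sig X 0 = 0.
  by have := sigL X 0 0 (-1); rewrite scaler0 addr0 scaleN1r addNr.
by elim/big_rec: _ => [//|j u _ IH]; rewrite sigL sigC sr scaler0 IH addr0.
Qed.

Let a_eq0 e : onb e -> (forall i j k, a e i j k = 0) -> forall X Y, sig X Y = 0.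
Proof.
move=> oe a0 X Y; apply: (sig_frame _ _ oe) => i j.
rewrite (normal_expand oe (sigJ _ _)) big1 // => l _.
by have := a0 i j l; rewrite /a => ->; rewrite scale0r.
Qed.

Lemma extrinsic_ricci_eq_cases (e0 : 'I_n -> 'rV[R]_n) : (1 < n)%N -> onb e0 ->
  (forall (e : 'I_n -> 'rV[R]_n) i, onb e -> q e i = (n%:R - 1) / (4 * n%:R) * dotm B (H e) (H e)) ->
  (forall X Y, sig X Y = 0) \/
  n = 2%N /\ exists e1 e2 mu, [/\ [/\ dotm A e1 e1 = 1, dotm A e2 e2 = 1 & dotm A e1 e2 = 0],
    sig e1 e1 = (3 * mu * s^-1) *: F e1, sig e2 e2 = (mu * s^-1) *: F e1 &
    sig e1 e2 = (mu * s^-1) *: F e2].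
Proof.
move=> n1 oe0 eqq.
have eqa e i : onb e ->
    \sum_(j | j != i) (\sum_l a e i i l * a e j j l - \sum_l a e i j l ^+ 2) =
    (n%:R - 1) / (4 * n%:R) * \sum_l (\sum_j a e j j l) ^+ 2.
  by move=> oe; rewrite -qE // -HE //; exact: eqq.
have ceq e i (oe : onb e) := cubic_eq (a12 e) (a23 e) n1 (eqa e i oe).
have T0 e (oe : onb e) : (forall l, \sum_j a e j j l = 0) -> forall X Y, sig X Y = 0.
  move=> t0; apply: (a_eq0 oe) => i j k.
  exact: (cubic_eq0 (a12 e) (a23 e) n1 (fun i => eqa e i oe) t0).
(* For [n > 2] each [T l] vanishes, by [cubic_eq] at some [i != l]. *)
have [n2|n2] := eqVneq n 2%N; last first.
  left; apply: (T0 e0 oe0) => l.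
  have [i il] : exists i, i != l.
    have : (0 < #|[pred i | i != l]|)%N.
      by rewrite (cardC1 l) card_ord -subn1 subn_gt0.
    by move=> /card_gt0P[i]; rewrite inE; exists i.
  have li : l != i by rewrite eq_sym.
  have [hl _] := ceq e0 i oe0; have [h _] := hl l li.
  move/eqP: h; rewrite mulf_eq0 => /orP[|/eqP //].
  by rewrite subr_eq0 (eqr_nat R n 2) (negPf n2).
(* [w] is the tangent vector dual to the trace of [sig]. *)
pose w := \sum_l dotm B (H e0) (F (e0 l)) *: e0 l.
have wE l : dotm A w (e0 l) = dotm B (H e0) (F (e0 l)).
  rewrite /w [LHS]dotm_suml (bigD1 l) //= [X in _ + X]big1 ?addr0 => [|k kl].
    by rewrite dotmZl oe0 eqxx mulr1.
  by rewrite dotmZl oe0 (negPf kl) mulr0.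
have Fs (Z : 'rV[R]_n) : F Z = \sum_l dotm A Z (e0 l) *: F (e0 l).
  have F0 : F 0 = 0 by have := FL 0 0 (-1); rewrite scaler0 addr0 scaleN1r addNr.
  rewrite {1}(orthonormal_expand pA oe0 Z).
  by elim/big_rec2: _ => [//|l u v _ IH]; rewrite FL IH.
have wF Z : dotm A w Z = dotm B (H e0) (F Z).
  rewrite (parseval pA oe0) Fs dotm_sumr; apply: eq_bigr => l _.
  by rewrite dotmZr wE mulrC.
have [w0|w0] := eqVneq w 0.
  left; apply: (T0 e0 oe0) => l; rewrite -TE -wF w0 dotm0l mul0r //.
right; split=> //.
have ww := pA.2 w w0.
have [e [i [oe ei]]] := orthonormal_extend pA (dotm_normalize pA w0).
have [j ji ij2] := ord2_other i n2.
(* [w] is a multiple of [e i], so the trace of [sig] has no component along [F (e j)]. *)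
have Tj : \sum_k a e k k j = 0.
  rewrite -TE (trace_frame_indep oe oe0) -wF.
  have -> : w = Num.sqrt (dotm A w w) *: e i.
    by rewrite ei scalerA mulfV ?scale1r // gt_eqF // sqrtr_gt0.
  by rewrite dotmZl oe eq_sym (negPf ji) mulr0 mul0r.
have big2 (V : zmodType) (f : 'I_n -> V) : \sum_k f k = f i + f j.
  rewrite (bigD1 i) //= (bigD1 j) //= big1 ?addr0 // => k /andP[ki kj].
  by have [kk|kk] := ij2 k; [rewrite kk eqxx in ki|rewrite kk eqxx in kj].
have ij : i != j by rewrite eq_sym.
(* Direction [i] gives [4 a_iij = T_j] and direction [j] gives [4 a_jji = T_i = a_iii + a_jji]. With
   [T_j = 0] this yields the factor 3 and the choice of [a_jji] for [mu]. *)
have [hl _] := ceq e i oe; have [_ hj] := hl j ji.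
have [{}hl _] := ceq e j oe; have [_ hi] := hl i ij.
rewrite Tj in hj; rewrite big2 in hi; move: Tj; rewrite big2 => Tj.
have aiij : a e i i j = 0 by lra.
have ajjj : a e j j j = 0 by lra.
have aiii : a e i i i = 3 * a e j j i by lra.
have expand k l : sig (e k) (e l) =
    a e k l i *: (s^-1 *: F (e i)) + a e k l j *: (s^-1 *: F (e j)).
  by rewrite {1}(normal_expand oe (sigJ _ _)) big2.
exists (e i), (e j), (a e j j i); split; first by rewrite !oe !eqxx eq_sym (negPf ji).
- by rewrite expand aiij scale0r addr0 aiii scalerA.
- by rewrite expand ajjj scale0r addr0 scalerA.
- by rewrite expand a23 aiij scale0r add0r a12 a23 scalerA.
Qed.

Lemma extrinsic_ricci_eq_geodesic (e : 'I_n -> 'rV[R]_n) i : (forall X Y, sig X Y = 0) ->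
  q e i = (n%:R - 1) / (4 * n%:R) * dotm B (H e) (H e).
Proof.
move=> s00; have -> : H e = 0 by rewrite big1.
by rewrite dotm0l mulr0 big1 // => j _; rewrite !s00 dotm0l subrr.
Qed.

(** The term [j = i] would be zero; once it is added, the sum is the trace of a bilinear form
    depending on the frame only through [e i]. *)
Lemma extrinsic_ricci_indep (e e' : 'I_n -> 'rV[R]_n) i i' : onb e -> onb e' ->
  e i = e' i' -> q e i = q e' i'.
Proof.
move=> oe oe' ee.
pose Q X (Y Z : 'rV[R]_n) : R := dotm B (sig X X) (sig Y Z) - dotm B (sig X Y) (sig X Z).
have QE (f : 'I_n -> 'rV[R]_n) k : q f k = \sum_j Q (f k) (f j) (f j).
  by rewrite [RHS](bigD1 k) //= {1}/Q subrr add0r.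
have Ql X Y Y' Z c : Q X (c *: Y + Y') Z = c *: Q X Y Z + Q X Y' Z.
  rewrite /Q sigL (sigC _ Z) sigL !(sigC Z) !dotm_lin /GRing.scale /=; ring.
have Qr X Y Z Z' c : Q X Y (c *: Z + Z') = c *: Q X Y Z + Q X Y Z'.
  rewrite /Q !sigL !dotm_lin /GRing.scale /=; ring.
rewrite !QE -(trace_orthonormal pA oe (Ql _) (Qr _)) ee.
exact: (trace_orthonormal pA oe' (Ql _) (Qr _)).
Qed.

(** In the coordinates of [e i] and [e j] with respect to [e1], [e2], the left-hand side is
    [2 * mu ^+ 2] times the squared determinant of the change of frame, hence the same in every
    direction. *)
Lemma extrinsic_ricci_eq_plane e1 e2 mu : n = 2%N ->
  dotm A e1 e1 = 1 -> dotm A e2 e2 = 1 -> dotm A e1 e2 = 0 ->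
  sig e1 e1 = (3 * mu * s^-1) *: F e1 -> sig e2 e2 = (mu * s^-1) *: F e1 ->
  sig e1 e2 = (mu * s^-1) *: F e2 ->
  forall (e : 'I_n -> 'rV[R]_n) i, onb e ->
  q e i = (n%:R - 1) / (4 * n%:R) * dotm B (H e) (H e).
Proof.
move=> n2 e11 e22 e12 s11 s22 s12 e i oe.
have [j ji ij2] := ord2_other i n2.
have big2 (V : zmodType) (f : 'I_n -> V) : \sum_k f k = f i + f j.
  rewrite (bigD1 i) //= (bigD1 j) //= big1 ?addr0 // => k /andP[ki kj].
  by have [kk|kk] := ij2 k; [rewrite kk eqxx in ki|rewrite kk eqxx in kj].
pose f k := if k == i then e1 else e2.
have fi : f i = e1 by rewrite /f eqxx.
have fj : f j = e2 by rewrite /f (negPf ji).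
have e21 : dotm A e2 e1 = 0 by rewrite (dotmC _ _ pA.1).
have of_ : onb f.
  move=> k l; have [->|->] := ij2 k; have [->|->] := ij2 l; rewrite ?fi ?fj.
  - by rewrite eqxx.
  - by rewrite eq_sym (negPf ji).
  - by rewrite (negPf ji).
  - by rewrite eqxx.
have ex k : e k = dotm A (e k) e1 *: e1 + dotm A (e k) e2 *: e2.
  by rewrite {1}(orthonormal_expand pA of_ (e k)) big2 fi fj.
set al := dotm A (e i) e1; set be := dotm A (e i) e2.
set ga := dotm A (e j) e1; set de := dotm A (e j) e2.
have ei : e i = al *: e1 + be *: e2 by exact: ex.
have ej : e j = ga *: e1 + de *: e2 by exact: ex.
have F12 u v u' v' : dotm B (u *: F e1 + v *: F e2) (u' *: F e1 + v' *: F e2) =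
    s ^+ 2 * (u * u' + v * v').
  by rewrite !dotm_lin !FF e11 e22 e12 e21; ring.
have sD X Y Y' : sig X (Y + Y') = sig X Y + sig X Y'.
  by have := sigL X Y Y' 1; rewrite !scale1r.
have sZ X Y c : sig X (c *: Y) = c *: sig X Y.
  have z0 : sig X 0 = 0.
    by have := sigL X 0 0 (-1); rewrite scaler0 addr0 scaleN1r addNr.
  by have := sigL X Y 0 c; rewrite z0 !addr0.
have sE a1 b1 a2 b2 : sig (a1 *: e1 + b1 *: e2) (a2 *: e1 + b2 *: e2) =
   ((3 * a1 * a2 + b1 * b2) * mu / s) *: F e1 + ((a1 * b2 + b1 * a2) * mu / s) *: F e2.
  rewrite sD !sZ ![sig (_ + _) _]sigC !sD !sZ s11 s22 s12 (sigC e2 e1) s12.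
  by apply/rowP => k; rewrite !mxE; ring.
have -> : q e i = \sum_k (dotm B (sig (e i) (e i)) (sig (e k) (e k)) -
    dotm B (sig (e i) (e k)) (sig (e i) (e k))).
  by rewrite [RHS](bigD1 i) //= subrr add0r.
rewrite big2 subrr add0r (trace_frame_indep oe of_) big2 fi fj s11 s22.
rewrite ei ej.
have -> : (3 * mu * s^-1) *: F e1 + (mu * s^-1) *: F e1 =
  (4 * mu / s) *: F e1 + 0 *: F e2.
  by apply/rowP => k; rewrite !mxE; ring.
rewrite !sE !F12 [in RHS]n2.
have dE u v u' v' : dotm A (u *: e1 + v *: e2) (u' *: e1 + v' *: e2) = u * u' + v * v'.
  by rewrite !dotm_lin e11 e22 e12 e21; ring.
have h1 : al * al + be * be = 1 by rewrite -dE -ei oe eqxx.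
have h2 : ga * ga + de * de = 1 by rewrite -dE -ej oe eqxx.
have h3 : al * ga + be * de = 0 by rewrite -dE -ei -ej oe eq_sym (negPf ji).
(* Lagrange's identity: an orthonormal change of frame has a determinant of square one. *)
have h4 : (al * de - be * ga) ^+ 2 = 1.
  have -> : (al * de - be * ga) ^+ 2 = (al * al + be * be) * (ga * ga + de * de)
    - (al * ga + be * de) ^+ 2 by ring.
  by rewrite h1 h2 h3; ring.
transitivity (2 * mu ^+ 2 * (al * de - be * ga) ^+ 2).
  by field.
by rewrite h4; field.
Qed.

End Pointwise.

(** * Ricci curvature of a slant immersion *)

Section SlantPoint.
Context {R : realType} {n : nat} {U : set 'rV[R]_n} {W : set 'rV[R]_(2 * n)}.
Context {S : local_immersion R n (2 * n)} {c theta : R} {x : 'rV[R]_n}.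
Local Notation h := (amb_metric S).
Local Notation J := (amb_J S).
Local Notation g := (induced_metric S).
Hypothesis oU : open U.
Hypothesis oW : open W.
Hypothesis UW : forall y, U y -> W (S y).
Hypothesis sS : smooth_on U S.
Hypothesis sh : smooth_on W h.
Hypothesis ph : forall z, W z -> posdef (h z).
Hypothesis rS : forall y, U y -> row_free ('J S y).
Hypothesis sJ : smooth_on W J.
Hypothesis pJ : forall z, W z -> parallel_at h (fun y Y => Y *m J y) z.
Hypothesis JJ : forall z, W z -> J z *m J z = - 1%:M.
Hypothesis hJ : forall z, W z -> forall X Y, dotm (h z) (X *m J z) (Y *m J z) = dotm (h z) X Y.
Hypothesis Ux : U x.
Hypothesis hc : forall X, X != 0 -> sectional h (S x) X (X *m J (S x)) = c.
Hypothesis hP : parallel_at g (PX S) x.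
Hypothesis hslant : forall X, X != 0 -> wirtinger_angle S x X = theta.
Hypothesis theta0 : theta != 0.
Hypothesis theta_pi2 : theta != pi / 2.
Local Opaque curvature christoffel_form derive dotm.

Let pg : posdef (g x) := posdef_induced UW ph rS Ux.
Let pB : posdef (h (S x)) := ph (UW Ux).

Let pythagoras X : dotm (g x) X X =
  dotm (g x) (PX S x X) (PX S x X) + dotm (h (S x)) (FX S x X) (FX S x X).
Proof.
rewrite (dotm_induced x X X) -(hJ (UW Ux)) -/(JX S x X) (JX_split x X).
by rewrite (dotm_split UW ph _ _ Ux) // => Z; exact: (FX_orth UW ph rS).
Qed.

Let amb_norm_JX X : amb_norm S x (JX S x X) = Num.sqrt (dotm (g x) X X).
Proof. by rewrite /amb_norm /normm /JX (hJ (UW Ux)) -dotm_induced. Qed.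

(** The bounds on [r], due to [pythagoras], are what allows [cos] and [sin] of [acos r] to be
    evaluated. *)
Let slant_ratio X : X != 0 -> exists r, [/\ theta = acos r, 0 <= r <= 1 &
  dotm (g x) (PX S x X) (PX S x X) = r ^+ 2 * dotm (g x) X X].
Proof.
move=> X0; have a0 := pg.2 X X0; have b0 := posdef_ge0 (PX S x X) pg.
have f0 := posdef_ge0 (FX S x X) pB.
exists (normm (g x) (PX S x X) / amb_norm S x (JX S x X)); split.
- by rewrite -(hslant X0).
- rewrite amb_norm_JX /normm divr_ge0 ?sqrtr_ge0 //= ler_pdivrMr ?sqrtr_gt0 //.
  by rewrite mul1r (ler_sqrt _ (ltW a0)) (pythagoras X) lerDl.
- by rewrite amb_norm_JX /normm expr_div_n !sqr_sqrtr ?(ltW a0) // mulfVK // gt_eqF.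
Qed.

Let PX_norm X : dotm (g x) (PX S x X) (PX S x X) = cos theta ^+ 2 * dotm (g x) X X.
Proof.
have [->|X0] := eqVneq X 0.
  by rewrite /PX /JX /tangential_part !mul0mx !dotm0l mulr0.
have [r [-> /andP[r0 r1] ->]] := slant_ratio X0.
by rewrite acosK // in_itv /= r1 (le_trans _ r0) // lerN10.
Qed.

Let FX_norm X : dotm (h (S x)) (FX S x X) (FX S x X) = sin theta ^+ 2 * dotm (g x) X X.
Proof.
by have := pythagoras X; rewrite PX_norm sin2cos2 mulrBl mul1r; lra.
Qed.

Let FX_lin X Y k : FX S x (k *: X + Y) = k *: FX S x X + FX S x Y.
Proof.
rewrite /FX /normal_part /tangential_part /JX !mulmxDl -!scalemxAl.
by rewrite scalerBr opprD addrACA.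
Qed.

Let FX_dotm X Y : dotm (h (S x)) (FX S x X) (FX S x Y) = sin theta ^+ 2 * dotm (g x) X Y.
Proof.
have := FX_norm (1 *: X + Y); rewrite FX_lin !scale1r.
rewrite (dotmDl _ (FX S x X) (FX S x Y)) !(dotmDr _ _ (FX S x X) (FX S x Y)).
rewrite (dotmC (FX S x Y) _ pB.1) (FX_norm X) (FX_norm Y).
rewrite (dotmDl _ X Y) !(dotmDr _ _ X Y) (dotmC Y _ pg.1) !mulrDr.
have aux (a b p q : R) : a + p + (p + b) = a + q + (q + b) -> p = q by lra.
exact: aux.
Qed.

(* [P] is skew, so in dimension one [P = 0] and [theta = pi / 2]. *)
Lemma slant_dim_gt1 : (0 < n)%N -> (1 < n)%N /\ 0 < sin theta.
Proof.
move=> n0; have [X XX] := posdef_unit_vector pg n0.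
have X0 : X != 0 by apply: contra_eq_neq XX => ->; rewrite dotm0l eq_sym oner_eq0.
have [r [tr /andP[r0 r1] _]] := slant_ratio X0.
have rI : -1 <= r <= 1 by rewrite r1 (le_trans _ r0) // lerN10.
split; last first.
  (* [sin theta] is the square root of [1 - r ^+ 2], which vanishes only for [r = 1], that is, for
     [theta = 0]. *)
  rewrite tr sin_acos // sqrtr_gt0 subr_gt0 expr_lt1 // lt_neqAle r1 andbT.
  by apply: contra theta0 => /eqP r1'; rewrite tr r1' acos1.
rewrite ltn_neqAle n0 andbT; apply: contra theta_pi2 => /eqP n1.
have [e [i [oe _]]] := orthonormal_extend pg XX.
have ji j : j = i.
  apply/val_inj; move: (ltn_ord i) (ltn_ord j).
  rewrite -[X in (i < X)%N]n1 -[X in (j < X)%N]n1 !ltnS !leqn0.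
  by move=> /eqP ei /eqP ej; exact: (etrans ej (esym ei)).
have Pii : dotm (g x) (PX S x (e i)) (e i) = 0.
  have := PX_skew UW ph rS JJ hJ (e i) (e i) Ux.
  by rewrite (dotmC (e i) _ pg.1); lra.
have := PX_norm (e i); rewrite oe eqxx mulr1 (parseval pg oe).
rewrite big1 => [/esym/eqP|j _]; last by rewrite (ji j) Pii mul0r.
rewrite sqrf_eq0 tr acosK; last by rewrite in_itv.
by move=> /eqP ->; rewrite acos0.
Qed.

Let sig := second_ff S x.
Let B := h (S x).
Let q (e : 'I_n -> 'rV[R]_n) i := \sum_(j | j != i)
  (dotm B (sig (e i) (e i)) (sig (e j) (e j)) - dotm B (sig (e i) (e j)) (sig (e i) (e j))).

Lemma sectional_slant X Y : dotm (g x) X X = 1 -> dotm (g x) Y Y = 1 ->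
  dotm (g x) X Y = 0 -> sectional g x X Y =
  c / 4 * (1 + 3 * dotm (g x) (PX S x X) Y ^+ 2) +
  (dotm B (sig X X) (sig Y Y) - dotm B (sig X Y) (sig X Y)).
Proof.
move=> X1 Y1 XY; rewrite /sectional X1 Y1 XY expr0n /= mulr1 subr0 divr1.
rewrite (gauss oU oW UW sS sh ph rS X Y Y X Ux).
rewrite (curvature_complex_space_form oW sh ph sJ pJ JJ hJ _ _ (UW Ux) hc).
rewrite -!dotm_induced X1 Y1 XY.
have -> : dotm (h (S x)) (X *m 'J S x) (Y *m 'J S x *m J (S x)) = - dotm (g x) (PX S x X) Y.
  by rewrite (dotm_PX UW ph rS) // (dotmJ_skew JJ hJ _ _ (UW Ux)) opprK.
rewrite (second_ff_sym oU oW UW sS sh ph rS Y X Ux) (dotmC (second_ff S x Y Y) _ pB.1).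
by rewrite sqrrN expr0n /= subr0 mulr1 -addrA.
Qed.

Lemma sectional_sum e i : orthonormal_basis (g x) e ->
  \sum_(j | j != i) sectional g x (e i) (e j) =
  4^-1 * ((n%:R - 1) * c + 3 * c * cos theta ^+ 2) + q e i.
Proof.
move=> oe; have n0 : (0 < n)%N := leq_ltn_trans (leq0n i) (ltn_ord i).
rewrite (eq_bigr (fun j => (c / 4 + 3 * c / 4 * dotm (g x) (PX S x (e i)) (e j) ^+ 2) +
  (dotm B (sig (e i) (e i)) (sig (e j) (e j)) -
   dotm B (sig (e i) (e j)) (sig (e i) (e j))))); last first.
  move=> j ji; rewrite sectional_slant ?oe ?eqxx //; last by rewrite eq_sym (negPf ji).
  by congr (_ + _); field.
rewrite big_split -/(q e i); congr (_ + _); rewrite big_split /= sumr_const -mulr_sumr.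
have -> : #|[pred j | j != i]| = n.-1 by rewrite -[n in RHS]card_ord (cardC1 i).
(* The sum is the full squared norm of [P e_i], since skewness of [P] kills the term [j = i]. *)
have -> : \sum_(j | j != i) dotm (g x) (PX S x (e i)) (e j) ^+ 2 = cos theta ^+ 2.
  have -> : cos theta ^+ 2 = dotm (g x) (PX S x (e i)) (PX S x (e i)).
    by rewrite PX_norm oe eqxx mulr1.
  rewrite (parseval pg oe) [RHS](bigD1 i) //=.
  have -> : dotm (g x) (PX S x (e i)) (e i) = 0.
    have := PX_skew UW ph rS JJ hJ (e i) (e i) Ux.
    by rewrite (dotmC (e i) _ pg.1); lra.
  by rewrite mul0r add0r; apply: eq_bigr => j _; rewrite expr2.
rewrite -[_ *+ n.-1]mulr_natr.
have -> : (n.-1)%:R = n%:R - 1 :> R by rewrite -subn1 natrB.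
by field.
Qed.

(** [xget] returns a genuine value because [X] extends to an orthonormal basis; which basis it used
    stays unknown, so [e] and [i] are existential. *)
Lemma Ric_slant X : dotm (g x) X X = 1 -> exists e i,
  [/\ orthonormal_basis (g x) e, e i = X &
  Ric g x X = 4^-1 * ((n%:R - 1) * c + 3 * c * cos theta ^+ 2) + q e i].
Proof.
move=> X1.
have [e [i [oe ei rE]]] : [set r | exists (e : 'I_n -> 'rV[R]_n) (i : 'I_n),
    [/\ orthonormal_basis (g x) e, e i = X &
        r = \sum_(j | j != i) sectional g x X (e j)]] (Ric g x X).
  apply: xgetPex; have [e [i [oe ei]]] := orthonormal_extend pg X1.
  by exists (\sum_(j | j != i) sectional g x X (e j)), e, i.
by exists e, i; split=> //; rewrite rE -ei sectional_sum.
Qed.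

Let sigL X Y Y' k : sig X (k *: Y + Y') = k *: sig X Y + sig X Y'.
Proof. exact: (second_ff_linr oU oW UW sS sh ph rS X Y Y' k Ux). Qed.

Let sigC X Y : sig X Y = sig Y X.
Proof. exact: (second_ff_sym oU oW UW sS sh ph rS X Y Ux). Qed.

Let sigJ X Y Z : dotm B (sig X Y) (Z *m 'J S x) = 0.
Proof. exact: (second_ff_orth UW ph rS X Y Z Ux). Qed.

Let sigF X Y Z : dotm B (sig Y X) (FX S x Z) = dotm B (sig Y Z) (FX S x X).
Proof. exact: (second_ff_cubic oU oW UW sS sh ph rS sJ pJ JJ hJ X Y Z Ux hP). Qed.

Let FJ X Z : dotm B (FX S x X) (Z *m 'J S x) = 0.
Proof. exact: (FX_orth UW ph rS X Z Ux). Qed.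

Lemma mean_curvature_slant e : orthonormal_basis (g x) e ->
  amb_norm S x (mean_curvature S x) ^+ 2 =
  n%:R^-1 ^+ 2 * dotm B (\sum_j sig (e j) (e j)) (\sum_j sig (e j) (e j)).
Proof.
move=> oe; rewrite /amb_norm /normm sqr_sqrtr; last exact: (posdef_ge0 _ pB).
rewrite /mean_curvature (trace_orthonormal pg oe) //.
  by rewrite dotmZl dotmZr mulrA -expr2.
by move=> X X' Y k; rewrite -/sig ![sig _ Y]sigC; exact: sigL.
Qed.

Let bound := 4^-1 * ((n%:R - 1) * n%:R * amb_norm S x (mean_curvature S x) ^+ 2
                       + (n%:R - 1) * c + 3 * c * cos theta ^+ 2).

(** The trace of [sig] is [n] times the mean curvature vector, which turns the factor [(n - 1) * n]
    into [(n - 1) / n]. *)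
Let boundE e : (0 < n)%N -> orthonormal_basis (g x) e ->
  bound = 4^-1 * ((n%:R - 1) * c + 3 * c * cos theta ^+ 2) +
  (n%:R - 1) / (4 * n%:R) * dotm B (\sum_j sig (e j) (e j)) (\sum_j sig (e j) (e j)).
Proof.
move=> n0 oe; rewrite /bound (mean_curvature_slant oe).
have nn : n%:R != 0 :> R by rewrite pnatr_eq0 -lt0n.
by field; rewrite nn.
Qed.

Let n_gt0 X : dotm (g x) X X = 1 -> (0 < n)%N.
Proof.
move=> X1; have [e [i _]] := orthonormal_extend pg X1.
exact: leq_ltn_trans (leq0n i) (ltn_ord i).
Qed.

Lemma Ric_slant_le X : dotm (g x) X X = 1 -> Ric g x X <= bound.
Proof.
move=> X1; have n0 := n_gt0 X1; have [n1 s0] := slant_dim_gt1 n0.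
have [e [i [oe _ ->]]] := Ric_slant X1.
rewrite (boundE n0 oe) lerD2l.
exact: (extrinsic_ricci_le pB (rS Ux) s0 FX_dotm FJ sigJ sigC sigF i n1 oe).
Qed.

Lemma Ric_slant_eqP :
  (forall X, dotm (g x) X X = 1 -> Ric g x X = bound) <->
  geodesic_point S x \/
  (n = 2%N /\ exists e1 e2 mu,
    [/\ [/\ dotm (g x) e1 e1 = 1, dotm (g x) e2 e2 = 1 & dotm (g x) e1 e2 = 0],
     sig e1 e1 = (3 * mu * (sin theta)^-1) *: FX S x e1,
     sig e2 e2 = (mu * (sin theta)^-1) *: FX S x e1 &
     sig e1 e2 = (mu * (sin theta)^-1) *: FX S x e2]).
Proof.
(* In dimension zero there are no unit vectors and every ambient vector is zero, so both sides
   hold. *)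
have [n00|n0] := posnP n.
  split=> [_|_ X /n_gt0]; last by rewrite lt0n => /eqP.
  by left=> X Y; apply/rowP => -[k hk]; exfalso; move: hk; rewrite [in X in (_ < X)%N]n00 muln0.
have [n1 s0] := slant_dim_gt1 n0.
split=> [eqR|eqR X X1].
  have [X0 XX] := posdef_unit_vector pg n0.
  have [e0 [i0 [oe0 _]]] := orthonormal_extend pg XX.
  apply: (extrinsic_ricci_eq_cases pg pB (rS Ux) s0 FX_dotm FX_lin FJ sigJ sigC sigL sigF n1 oe0).
  move=> e i oe.
  have ei1 : dotm (g x) (e i) (e i) = 1 by rewrite oe eqxx.
  have [e' [i' [oe' ei' RE]]] := Ric_slant ei1.
  have := eqR _ ei1; rewrite RE (boundE n0 oe) => /addrI <-.
  exact: (extrinsic_ricci_indep pg sigC sigL oe oe' (esym ei')).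
have [e [i [oe _ ->]]] := Ric_slant X1.
rewrite (boundE n0 oe); congr (_ + _).
case: eqR => [geo|[n2 [e1 [e2 [mu [[e11 e22 e12] s11 s22 s12]]]]]].
  exact: extrinsic_ricci_eq_geodesic.
exact: (extrinsic_ricci_eq_plane pg s0 FX_dotm sigC sigL n2 e11 e22 e12 s11 s22 s12 i oe).
Qed.

Lemma amb_norm_FX X : dotm (g x) X X = 1 -> amb_norm S x (FX S x X) = sin theta.
Proof.
move=> X1; rewrite /amb_norm /normm FX_norm X1 mulr1 sqrtr_sqr gtr0_norm //.
exact: (slant_dim_gt1 (n_gt0 X1)).2.
Qed.

End SlantPoint.

(** * From coordinates to the manifolds *)

(** [chart_inv] is meaningful only on the image of the chart, so the neighbourhood given by its
    continuity is intersected with that open image. *)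
Lemma open_coord_dom (R : realType) (M N : topologicalType) (m n : nat)
    (phi : chart R M m) (psi : chart R N n) (f : M -> N) :
  continuous f -> open (coord_dom phi psi f).
Proof.
move=> cf; rewrite openE => y [q [dq dfq] <-].
have nq : nbhs q (chart_dom phi `&` f @^-1` chart_dom psi).
  apply: open_nbhs_nbhs; split=> //; apply: openI; first exact: chart_domO.
  by apply: open_comp => [z _|]; [exact: cf|exact: chart_domO].
have ni : nbhs (phi q) (chart_inv phi @^-1` (chart_dom phi `&` f @^-1` chart_dom psi)).
  by apply: (chart_inv_continuous dq); rewrite chart_mapK.
have nc : nbhs (phi q) (phi @` chart_dom phi).
  by apply: open_nbhs_nbhs; split; [exact: chart_codO|exists q].
apply: filterS2 ni nc => z iz [q' dq' zE]; exists q' => //.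
by move: iz; rewrite -zE /= chart_mapK.
Qed.

Unset Implicit Arguments.
Set Strict Implicit.

Theorem theorem5p1 (R : realType) (n : nat) (M : manifold R n)
    (N : almost_hermitian R (2 * n)) (f : M -> N) (c theta : R)
    (hN : complex_space_form N c) (hf : immersion f)
    (hM : kaehlerian_slant f theta)
    (p : M) (phi : chart R M n) (psi : chart R N (2 * n))
    (hphi : chart_at p phi) (hpsi : chart_at (f p) psi) :
  let imm := in_charts f phi psi in
  let x := phi p in
  let g := induced_metric imm in
  let sigma := second_ff imm x in
  let F := FX imm x in
  let bound := 4^-1 * ((n%:R - 1) * n%:R * amb_norm imm x (mean_curvature imm x) ^+ 2
                       + (n%:R - 1) * c + 3 * c * cos theta ^+ 2) in
  (forall X, dotm (g x) X X = 1 -> Ric g x X <= bound) /\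
  ((forall X, dotm (g x) X X = 1 -> Ric g x X = bound) <->
   geodesic_point imm x \/
   (n = 2%N /\
    exists (e1 e2 : 'rV[R]_n) (mu : R),
      [/\ [/\ normm (g x) e1 = 1, normm (g x) e2 = 1 & dotm (g x) e1 e2 = 0],
          sigma e1 e1 = (3 * mu / amb_norm imm x (F e1)) *: F e1 /\
          sigma e1 e1 = (3 * mu * (sin theta)^-1) *: F e1,
          sigma e2 e2 = (mu / amb_norm imm x (F e1)) *: F e1 /\
          sigma e2 e2 = (mu * (sin theta)^-1) *: F e1
        & sigma e1 e2 = (mu / amb_norm imm x (F e2)) *: F e2 /\
          sigma e1 e2 = (mu * (sin theta)^-1) *: F e2])).
Proof.
move=> imm x g sigma F bound.
have [[cf sf] rf] := hf; have [kN cN] := hN; have [[slM th0 thpi] parM] := hM.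
have [aphi dphi] := hphi; have [apsi dpsi] := hpsi.
(* Differentiation at [x] requires the hypotheses on a neighbourhood. Each point of [U] or [W] is
   the coordinate vector of a point of the manifold, at which the global hypotheses apply. *)
pose U := coord_dom phi psi f; pose W := psi @` chart_dom psi.
have oU : open U := open_coord_dom cf.
have oW : open W := @chart_codO _ _ _ psi.
have UE y : U y -> exists q, [/\ y = phi q, chart_at q phi, chart_at (f q) psi &
    imm y = psi (f q)].
  move=> [q [dq dfq] <-]; exists q; split=> //.
  by rewrite /imm /in_charts /= /coord_map chart_mapK.
have WE z : W z -> exists2 q, z = psi q & chart_at q psi.
  by move=> [q dq <-]; exists q.
have UW y : U y -> W (imm y) by move=> /UE[q [_ _ [_ dq] ->]]; exists (f q).
have sS : smooth_on U imm := sf phi psi aphi apsi.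
have sh : smooth_on W (amb_metric imm) := metric_smooth (ah_metric N) apsi.
have ph z : W z -> posdef (amb_metric imm z).
  move=> /WE[q -> hq]; split; first exact: (Defs.metric_sym (ah_metric N) hq).
  by move=> X; exact: (metric_posdef (ah_metric N) hq).
have rS y : U y -> row_free ('J imm y).
  by move=> /UE[q [-> hq hfq _]]; exact: (rf q phi psi).
have sJ : smooth_on W (amb_J imm) := acs_smooth (ah_J N) apsi.
have pJ z : W z -> parallel_at (amb_metric imm) (fun y Y => Y *m amb_J imm y) z.
  by move=> /WE[q -> hq]; exact: (kN q psi hq).
have JJ z : W z -> amb_J imm z *m amb_J imm z = - 1%:M.
  by move=> /WE[q -> hq]; exact: (acs_sqr (ah_J N) hq).
have hJ z : W z -> forall X Y, dotm (amb_metric imm z) (X *m amb_J imm z) (Y *m amb_J imm z)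
    = dotm (amb_metric imm z) X Y.
  by move=> /WE[q -> hq]; exact: (ah_compatible hq).
have Ux : U x by exists p.
have hc X : X != 0 -> sectional (amb_metric imm) (imm x) X (X *m amb_J imm (imm x)) = c.
  by have /WE[q -> hq] := UW x Ux; exact: (cN q psi hq).
have hP : parallel_at (induced_metric imm) (PX imm) x := parM p phi psi hphi hpsi.
have hslant := slM p phi psi hphi hpsi.
have onn (X : 'rV[R]_n) : normm (g x) X = 1 <-> dotm (g x) X X = 1.
  split=> [X1|]; last by rewrite /normm => ->; rewrite sqrtr1.
  by rewrite -[LHS]sqr_sqrtr ?[Num.sqrt _]X1 ?expr1n // (posdef_ge0 X (posdef_induced UW ph rS Ux)).
(* For a unit vector [e] the norm of [F e] is [sin theta], so the two forms of each equation in (b)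
   coincide. *)
have nF := amb_norm_FX UW ph rS JJ hJ Ux hslant th0 thpi.
split.
  exact: (Ric_slant_le oU oW UW sS sh ph rS sJ pJ JJ hJ Ux hc hP hslant th0 thpi).
apply: (iff_trans (Ric_slant_eqP oU oW UW sS sh ph rS sJ pJ JJ hJ Ux hc hP hslant th0 thpi)).
split=> -[geo|[n2 [e1 [e2 [mu [[e11 e22 e12] s11 s22 s12]]]]]]; [by left| |by left|].
  right; split=> //; exists e1, e2, mu; rewrite !nF //.
  by split=> //; split=> //; exact/onn.
right; split=> //; exists e1, e2, mu.
move: s11 s22 s12 => [_ s11] [_ s22] [_ s12].
by split=> //; split=> //; exact/onn.
Qed.
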